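(* Consider the Best-of-three on the stochastic block model $G(2n,p,q)$, where $p$ and $q$ are positive constants. If $\frac qp>\frac17$, then $G(2n,p,q)$ w.h.p. satisfies the following property: there exist two positive constants $C,C'>0$ such that $$\forall A\subseteq V:\quad \Pr\left[T_{\mathrm{cons}}(A)\le C\log n\right]\ge 1-O(n^{-C'}).$$
   Context: Stochastic block model: for $n\in\mathbb N$ and $p,q\in[0,1]$ with $q\le p$, $G(2n,p,q)$ is the random graph on $V=V_1\cup V_2$, $|V_1|=|V_2|=n$, $V_1\cap V_2=\emptyset$, in which each pair of distinct vertices $u\in V_i$, $v\in V_j$ forms an edge independently with probability $p$ if $i=j$ and $q$ if $i\ne j$. Best-of-three: each vertex of a graph $G=(V,E)$ holds an opinion in $\{1,2\}$. In each synchronous discrete step, every vertex independently samples three uniformly random neighbors (with replacement) and adopts the majority opinion among them. If $A$ is the set of vertices with opinion 1, $A'$ denotes the set of vertices with opinion 1 after one step. The graph is generated first and then kept fixed; then an initial set $A^{(0)}=A$ is chosen and $A^{(t+1)}=(A^{(t)})'$. The consensus time is $T_{\mathrm{cons}}(A)=\min\{t\ge0: A^{(t)}\in\{\emptyset,V\},\ A^{(0)}=A\}$. In the displayed inequality $\Pr$ is over the voting process on the fixed graph; ''w.h.p.'' refers to the random graph. Asymptotics are as $n\to\infty$. ''W.h.p.'' means with probability at least $1-n^{-c}$ for some constant $c>0$. ''Constant'' means independent of $n$. *)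

(* Defs.v *)
From HB Require Import structures.
From mathcomp Require Import all_boot all_order all_algebra.
From mathcomp Require Import boolp reals exp.

Set Implicit Arguments.
Unset Strict Implicit.
Unset Printing Implicit Defensive.

Import Order.TTheory GRing.Theory Num.Theory.

Local Open Scope ring_scope.

(* The block of a vertex is its first component, so V_1 and V_2 are the fibres
   of fst and each of them has n elements. *)
Definition sbm_vertex (n : nat) : finType := (bool * 'I_n)%type.

(* A simple graph on V is represented by its set of edges, a subset of
   vpairs V. *)
Definition vpairs (V : finType) : {set {set V}} :=
  [set e : {set V} | #|e| == 2%N].

Definition neighbors (V : finType) (G : {set {set V}}) (v : V) : {set V} :=
  [set u | [set v; u] \in G].

Section StochasticBlockModel.
Variables (R : realType) (n : nat) (p q : R).

Definition edge_prob (e : {set sbm_vertex n}) : R :=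
  if [forall u in e, forall v in e, u.1 == v.1] then p else q.

Definition sbm_weight (G : {set {set sbm_vertex n}}) : R :=
  \prod_(e in vpairs (sbm_vertex n))
    (if e \in G then edge_prob e else 1 - edge_prob e).

Definition sbm_Pr (Q : {set {set sbm_vertex n}} -> Prop) : R :=
  \sum_(G in powerset (vpairs (sbm_vertex n)) | `[< Q G >]) sbm_weight G.

End StochasticBlockModel.

Section BestOfThree.
Variables (V : finType) (G : {set {set V}}).

(* One round of sampling: r (v, i) is the i-th neighbor sampled by v. *)
Definition sampling : finType := {ffun V * 'I_3 -> V}.

Definition valid_sampling (r : sampling) : bool :=
  [forall v, forall i, r (v, i) \in neighbors G v].

(* Opinion sets are the sets of vertices with opinion 1. *)
Definition best_of_three (A : {set V}) (r : sampling) : {set V} :=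
  [set v | (2 <= #|[set i | r (v, i) \in A]|)%N].

(* The sequence A^(0), ..., A^(T) determined by T rounds of sampling. *)
Definition opinions (T : nat) (A : {set V}) (s : T.-tuple sampling) :
    seq {set V} :=
  A :: scanl best_of_three A s.

Definition consensus (B : {set V}) : bool := (B == set0) || (B == setT).

(* The first t with A^(t) in {set0, setT}; it is T + 1 when there is no such t
   among 0, ..., T. Hence, for x <= T, the first T rounds decide whether the
   consensus time is at most x, and this number has the right answer. *)
Definition Tcons (T : nat) (A : {set V}) (s : T.-tuple sampling) : nat :=
  find consensus (opinions A s).

(* The law of the first T rounds: uniform on the sequences of valid samplings,
   which is a product set, so that all the samples are independent and uniform
   among the neighbors of the sampling vertex. If some vertex is isolated, the
   process is undefined, and for T > 0 this gives every event probability
   0 / 0 = 0. *)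
Definition vote_Pr (R : realType) (T : nat) (E : pred (T.-tuple sampling)) : R :=
  #|[set s : T.-tuple sampling | all valid_sampling s & E s]|%:R
  / #|[set s : T.-tuple sampling | all valid_sampling s]|%:R.

End BestOfThree.

(* Main.v *)
Require Import Defs.
From mathcomp Require Import all_boot all_order all_algebra.
From mathcomp Require Import boolp reals sequences exp.
From mathcomp Require Import ring lra zify.

Set Implicit Arguments.
Unset Strict Implicit.
Unset Printing Implicit Defensive.

Import Order.TTheory GRing.Theory Num.Theory.

Local Open Scope ring_scope.

(** Describe an opinion set by the half-sum alpha and the half-difference beta
    of the biases of the two blocks, and put w = u beta with
    u = (p - q) / (p + q). If every vertex saw exactly the expected composition
    of its neighbourhood, one round would send
      alpha to alpha (3 - alpha^2 - 3 w^2) / 2,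
      w to u w (3 - 3 alpha^2 - w^2) / 2.
    On the axis alpha = 0 the second map contracts towards w^2 = 3 - 2 / u when
    u > 2/3, and towards 0 otherwise, while alpha is multiplied by
    3 (1 - w^2) / 2. This multiplier exceeds 1 at the fixed point precisely when
    u < 3/4, that is, q / p > 1/7. Hence |w| falls below a threshold [w0] with
    w0^2 < 1/3, then |alpha| grows; moreover the slope w / alpha shrinks by the
    factor 4u/3 < 1 in each round, so that the orbit ends at alpha = 1 or -1
    ([diff_contracts], [diff_stays], [sum_grows], [slope_step]).

    The graph enters through two properties ([typical]): linear minimum degree,
    and an l^1 bound of order n^(3/2), valid for all A at once, on the difference
    between the numbers of neighbours in A and their expectations. The second is
    a union bound over the 16^n pairs of a set A and a choice of signs, which
    the exponential moments of a linear statistic absorb ([typical_whp]).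
    Since the probability of adopting an opinion is a Lipschitz function of the
    fraction of neighbours holding it, the conditional mean of the next opinion
    set differs from the map above by O(sqrt n) vertices, however A was chosen
    ([adopt_bias]).

    This error and the random fluctuations of one round have the same order, so
    that near the axis no drift is available. Instead, for every constant h, a
    fluctuation beyond h sqrt n has a probability bounded below
    ([anticoncentration]), and for h large the drift wins against both errors
    from there on. The potential min(1, h / (sqrt n |alpha|)) combines both
    regimes: it decreases by a constant factor in expectation in each round
    ([escape_far], [escape_close]). As it ranges between n^(-1/2) and 1 up to
    constants, O(log n) rounds suffice to leave the axis ([miss_drift]).

    All regimes are treated in this way, with the potentials |w|,
    min(1, h / (sqrt n |alpha|)), |w / alpha| plus a multiple of 1 - |alpha|, and
    the size of the minority; for the last one, the expected number of vertices
    adopting a small minority opinion is quadratic in its size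
    ([adopt_small]). *)

(** * Exponential moments of random subsets *)

Section ExpBounds.
Variable R : realType.
Implicit Types x : R.

(** The argument goes through [expR x <= (1 - x)^-1]. *)
Lemma expR_le_quad x : `|x| <= 1 / 2 -> expR x <= 1 + x + 2 * x ^+ 2.
Proof.
rewrite ler_norml => /andP[xl xu].
have h := expR_ge1Dx (- x); have e0 := expR_gt0 x.
have h1 : expR x * (1 - x) <= 1.
  by apply: le_trans (ler_wpM2l (ltW e0) h) _; rewrite expRxMexpNx_1.
have h2 : 1 <= (1 + x + 2 * x ^+ 2) * (1 - x) by nra.
have x1 : 0 < 1 - x by lra.
by rewrite -(ler_pM2r x1); apply: le_trans h1 h2.
Qed.

(** Squaring [1 + x / 2 <= expR (x / 2)] produces the quadratic term. *)
Lemma expR_ge_quad x : `|x| <= 1 / 2 -> 1 + x + x ^+ 2 / 4 <= expR x.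
Proof.
rewrite ler_norml => /andP[xl xu].
have h := expR_ge1Dx (x / 2).
have -> : x = x / 2 + x / 2 by lra.
rewrite expRD; nra.
Qed.

(** The converse of [1 + x <= expR x] up to a constant, which turns lower bounds
    on the factors of a product into an exponential lower bound. *)
Lemma expR_half_le x : 0 <= x <= 1 -> expR (x / 2) <= 1 + x.
Proof.
move=> /andP[x0 x1].
have hx : `|x / 2| <= 1 / 2 by rewrite ler_norml; apply/andP; split; lra.
apply: le_trans (expR_le_quad hx) _; nra.
Qed.

Lemma expRN_le_inv x : 0 < x -> expR (- x) <= x^-1.
Proof.
move=> x0; rewrite expRN lef_pV2 ?posrE ?expR_gt0//.
by apply: le_trans (expR_ge1Dx x); lra.
Qed.

Lemma expRN_le_inv3 x : 0 < x -> expR (- x) <= 27 * x ^- 3.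
Proof.
move=> x0; have h := expRN_le_inv (x := x / 3) ltac:(lra).
have -> : - x = - (x / 3) + (- (x / 3) + - (x / 3)) by lra.
rewrite !expRD -!expr2 -exprS.
have -> : 27 * x ^- 3 = ((x / 3)^-1) ^+ 3 by field; rewrite gt_eqF.
by rewrite lerXn2r ?nnegrE ?expR_ge0// invr_ge0; lra.
Qed.

Lemma expR_ge_pow (m : nat) : 2 ^+ m <= expR (m%:R : R).
Proof.
rewrite -[m%:R]mul1r expRM_natr lerXn2r ?nnegrE ?expR_ge0//.
by apply: le_trans (expR_ge1Dx 1); lra.
Qed.

End ExpBounds.

Section RandomSubset.
Variables (R : realType) (I : finType).
Implicit Types (P : I -> R) (B : {set I}) (phi psi : {set I} -> R) (c : I -> R).

(** The law of a random subset that contains each i independently with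
    probability P i. Both the edge set of the random graph and the opinion set
    after one round are of this kind. *)
Definition bern P B : R := \prod_i (if i \in B then P i else 1 - P i).

Definition Ex P phi : R := \sum_B bern P B * phi B.

Definition Pr P (E : pred {set I}) : R := Ex P (fun B => (E B)%:R).

Lemma Ex_prod P (g : I -> bool -> R) :
  Ex P (fun B => \prod_i g i (i \in B)) =
  \prod_i (P i * g i true + (1 - P i) * g i false).
Proof.
rewrite bigA_distr.
apply: eq_bigr => B _; rewrite /bern -big_split/=.
by apply: eq_bigr => i _; case: ifP.
Qed.

Lemma eq_Ex P phi psi : phi =1 psi -> Ex P phi = Ex P psi.
Proof. by move=> e; apply: eq_bigr => B _; rewrite e. Qed.

Lemma Ex_cst P (k : R) : Ex P (fun=> k) = k.
Proof.
rewrite /Ex -mulr_suml -[RHS]mul1r; congr (_ * _).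
have := Ex_prod P (fun _ _ => 1).
have -> : Ex P (fun B => \prod_(i : I) 1) = \sum_B bern P B.
  by apply: eq_bigr => B _; rewrite big1// mulr1.
by move=> ->; rewrite big1// => i _; rewrite !mulr1 subrKC.
Qed.

Lemma ExD P phi psi : Ex P (fun B => phi B + psi B) = Ex P phi + Ex P psi.
Proof. by rewrite /Ex -big_split/=; apply: eq_bigr => B _; rewrite mulrDr. Qed.

Lemma ExZ P (k : R) phi : Ex P (fun B => k * phi B) = k * Ex P phi.
Proof.
by rewrite /Ex mulr_sumr; apply: eq_bigr => B _; rewrite mulrCA.
Qed.

Lemma Ex_sum P (J : finType) (phi : J -> {set I} -> R) :
  Ex P (fun B => \sum_j phi j B) = \sum_j Ex P (phi j).
Proof.
by rewrite /Ex exchange_big/=; apply: eq_bigr => B _; rewrite mulr_sumr.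
Qed.

Lemma Ex_mem P i : Ex P (fun B => (i \in B)%:R) = P i.
Proof.
have := Ex_prod P (fun j b => if j == i then b%:R else 1).
under eq_Ex do rewrite -big_mkcond big_pred1_eq.
move=> ->; rewrite (bigD1 i)//= eqxx big1 ?mulr1 ?mulr0 ?addr0//.
by move=> j /negPf ->; rewrite !mulr1 subrKC.
Qed.

Section Bounded.
Variable P : I -> R.
Hypothesis P01 : forall i, 0 <= P i <= 1.

Lemma bern_ge0 B : 0 <= bern P B.
Proof.
apply: prodr_ge0 => i _; have /andP[p0 p1] := P01 i.
by case: ifP => _ //; rewrite subr_ge0.
Qed.

Lemma ler_Ex phi psi : (forall B, phi B <= psi B) -> Ex P phi <= Ex P psi.
Proof. by move=> h; apply: ler_sum => B _; rewrite ler_wpM2l// bern_ge0. Qed.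

Lemma Pr_not (E : pred {set I}) : Pr P (fun B => ~~ E B) = 1 - Pr P E.
Proof.
rewrite -[in RHS](Ex_cst P 1); apply/eqP; rewrite eq_sym subr_eq -ExD.
by apply/eqP/eq_Ex => B; case: (E B); rewrite /= ?addr0 ?add0r.
Qed.

Lemma Pr_le (E F : pred {set I}) :
  (forall B, E B -> F B) -> Pr P E <= Pr P F.
Proof.
move=> h; apply: ler_Ex => B; rewrite ler_nat.
by case: (boolP (E B)) => // /h ->.
Qed.

Lemma Pr_or (E F : pred {set I}) :
  Pr P (fun B => E B || F B) <= Pr P E + Pr P F.
Proof.
rewrite -ExD; apply: ler_Ex => B; rewrite -natrD ler_nat.
by case: (E B); case: (F B).
Qed.

Lemma Pr_exists (J : finType) (E : J -> pred {set I}) :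
  Pr P (fun B => [exists j, E j B]) <= \sum_j Pr P (E j).
Proof.
rewrite -Ex_sum; apply: ler_Ex => B.
case: existsP => [[j Ej]|_]; last exact: sumr_ge0.
by rewrite (bigD1 j)//= Ej lerDl sumr_ge0.
Qed.

(** The centred linear statistics of a random subset; every deviation bound
    below comes from their exponential moments. *)
Definition lin c B : R := \sum_i c i * ((i \in B)%:R - P i).

Lemma Ex_expR_lin c :
  Ex P (fun B => expR (lin c B)) =
  \prod_i (P i * expR (c i * (1 - P i)) + (1 - P i) * expR (- (c i * P i))).
Proof.
have -> : \prod_i (P i * expR (c i * (1 - P i)) +
    (1 - P i) * expR (- (c i * P i))) =
    Ex P (fun B => \prod_i expR (c i * ((i \in B)%:R - P i))).
  rewrite (Ex_prod P (fun i b => expR (c i * (b%:R - P i)))).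
  by apply: eq_bigr => i _; rewrite sub0r mulrN.
by apply: eq_Ex => B; rewrite /lin expR_sum.
Qed.

Lemma half_range c i (t : R) : `|c i| <= 1 / 2 -> 0 <= t <= 1 ->
  `|c i * t| <= 1 / 2.
Proof.
move=> hc /andP[t0 t1]; rewrite normrM (ger0_norm t0).
by rewrite -[1/2]mulr1 ler_pM.
Qed.

(** The linear terms cancel because the statistic is centred, so each factor is
    at most 1 + 2 (c i)^2. *)
Lemma mgf_le c : (forall i, `|c i| <= 1 / 2) ->
  Ex P (fun B => expR (lin c B)) <= expR (2 * \sum_i c i ^+ 2).
Proof.
move=> hc; rewrite Ex_expR_lin mulr_sumr expR_sum.
apply: ler_prod => i _; have /andP[p0 p1] := P01 i.
rewrite addr_ge0 ?mulr_ge0 ?expR_ge0 ?subr_ge0//=.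
have h1 := expR_le_quad (half_range (t := 1 - P i) (hc i) ltac:(lra)).
have h2 := expR_le_quad (x := - (c i * P i))
             ltac:(rewrite normrN; exact: half_range (hc i) (P01 i)).
apply: le_trans (expR_ge1Dx _).
have h3 := ler_wpM2l p0 h1.
have h4 := ler_wpM2l (x := 1 - P i) ltac:(lra) h2.
have cc := sqr_ge0 (c i).
have pp : P i * (1 - P i) <= 1 by nra.
have : P i * (1 - P i) * c i ^+ 2 <= c i ^+ 2 by rewrite ler_piMl.
lra.
Qed.

Lemma mgf_ge c : (forall i, `|c i| <= 1 / 2) ->
  expR (\sum_i c i ^+ 2 * (P i * (1 - P i)) / 8) <=
  Ex P (fun B => expR (lin c B)).
Proof.
move=> hc; rewrite Ex_expR_lin expR_sum.
apply: ler_prod => i _; have /andP[p0 p1] := P01 i.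
rewrite expR_ge0 /=.
have h1 := expR_ge_quad (half_range (t := 1 - P i) (hc i) ltac:(lra)).
have h2 := expR_ge_quad (x := - (c i * P i))
             ltac:(rewrite normrN; exact: half_range (hc i) (P01 i)).
have h3 := ler_wpM2l p0 h1.
have h4 := ler_wpM2l (x := 1 - P i) ltac:(lra) h2.
have cc : 0 <= c i ^+ 2 <= 1 / 4.
  by have := hc i; rewrite ler_norml => /andP[? ?]; apply/andP; split; nra.
have pp : 0 <= P i * (1 - P i) <= 1 by apply/andP; split; nra.
have h : expR (c i ^+ 2 * (P i * (1 - P i)) / 4 / 2) <=
         1 + c i ^+ 2 * (P i * (1 - P i)) / 4.
  apply: expR_half_le; move: cc pp; set a := _ ^+ 2; set b := P i * _.
  by move=> /andP[? ?] /andP[? ?]; apply/andP; split; nra.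
have -> : c i ^+ 2 * (P i * (1 - P i)) / 8 =
          c i ^+ 2 * (P i * (1 - P i)) / 4 / 2 by lra.
apply: le_trans h _; lra.
Qed.

Lemma linZ (k : R) c B : lin (fun i => k * c i) B = k * lin c B.
Proof. by rewrite /lin mulr_sumr; apply: eq_bigr => i _; rewrite mulrA. Qed.

Lemma tail_le c (l t : R) : 0 <= l -> (forall i, `|l * c i| <= 1 / 2) ->
  Pr P (fun B => t <= lin c B) <= expR (2 * l ^+ 2 * \sum_i c i ^+ 2 - l * t).
Proof.
move=> l0 hc.
have -> : 2 * l ^+ 2 * \sum_i c i ^+ 2 = 2 * \sum_i (l * c i) ^+ 2.
  by rewrite -mulrA mulr_sumr; congr (_ * _); apply: eq_bigr => i _; ring.
rewrite expRD -ler_pdivrMr ?expR_gt0// -expRN opprK mulrC -ExZ.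
apply: le_trans (mgf_le hc); apply: ler_Ex => B.
rewrite linZ; case: (boolP (t <= _)) => h; last by rewrite mulr0 expR_ge0.
by rewrite mulr1 ler_expR ler_wpM2l.
Qed.

Lemma linN c B : lin (fun i => - c i) B = - lin c B.
Proof. by rewrite /lin -sumrN; apply: eq_bigr => i _; rewrite mulNr. Qed.

(** An exponential bound, weakened to the form of Chebyshev's inequality. *)
Lemma tail_unit c (N s : R) : (forall i, `|c i| <= 1) ->
  #|I|%:R <= N -> 0 < s <= 2 * N ->
  Pr P (fun B => s <= `|lin c B|) <= 16 * N / s ^+ 2.
Proof.
move=> hc hI /andP[s0 sN]; have N0 : 0 < N by lra.
(* the minimizer of the exponent 2 l^2 N - l s *)
pose l := s / (4 * N).
have l0 : 0 < l by rewrite divr_gt0//; lra.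
have l1 : l <= 1 / 2 by rewrite /l ler_pdivrMr; lra.
have main c' : (forall i, `|c' i| <= 1) ->
    Pr P (fun B => s <= lin c' B) <= 8 * N / s ^+ 2.
  move=> hc'; apply: le_trans (tail_le (l := l) _ _ _) _ => //.
  - exact: ltW.
  - by move=> i; rewrite normrM gtr0_norm// -[1/2]mulr1 ler_pM// ltW.
  have sq : \sum_i c' i ^+ 2 <= N.
    apply: le_trans hI; rewrite -sum1_card natr_sum; apply: ler_sum => i _.
    by rewrite -real_normK ?num_real// exprn_ile1.
  apply: (@le_trans _ _ (expR (- (s ^+ 2 / (8 * N))))).
    rewrite ler_expR.
    have -> : - (s ^+ 2 / (8 * N)) = 2 * l ^+ 2 * N - l * s.
      by rewrite /l; field; rewrite gt_eqF.
    by rewrite lerD2r ler_wpM2l// mulr_ge0// sqr_ge0.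
  apply: le_trans (expRN_le_inv _) _.
    by rewrite divr_gt0 ?exprn_gt0//; lra.
  by rewrite invf_div.
apply: (@le_trans _ _ (Pr P (fun B => s <= lin c B) +
                       Pr P (fun B => s <= lin (fun i => - c i) B))).
  apply: le_trans (Pr_or _ _); apply: Pr_le => B.
  by rewrite linN lerNr ler_normr lerNr.
have := main _ hc; have := main (fun i => - c i).
have h i : `|- c i| <= 1 by rewrite normrN.
move=> /(_ h); set a := Pr _ _; set b := Pr _ _.
have -> : 16 * N / s ^+ 2 = 8 * N / s ^+ 2 + 8 * N / s ^+ 2.
  by rewrite -mulrDl; congr (_ / _); ring.
by move=> ? ?; apply: lerD.
Qed.

(** Deviations by any multiple H of sqrt n have a probability bounded below
    independently of n. A second moment argument on the statistic itself would
    only give a small multiple; applied, as Paley and Zygmund do, to its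
    exponential with parameter L / sqrt n, it reaches the height L a / 8 sqrt n
    up to lower order terms, and L is free. *)
Lemma anticoncentration (a H : R) (n : nat) : 0 < a <= 1 -> 0 <= H ->
  let L := 8 * (H + 2) / a in
  16 * L ^+ 2 <= n%:R -> #|I|%:R <= 2 * n%:R :> R ->
  a * n%:R <= \sum_i P i * (1 - P i) ->
  expR (L ^+ 2 * a / 4 - 16 * L ^+ 2) / 2 <=
    Pr P (fun B => H * Num.sqrt n%:R <= lin (fun=> 1) B).
Proof.
move=> /andP[a0 a1] H0 L Ln hI hv.
have L1 : 1 <= L.
  by rewrite /L ler_pdivlMr//; nra.
set r := Num.sqrt n%:R.
have n0 : 0 < n%:R :> R.
  by apply: lt_le_trans Ln; rewrite mulr_gt0// exprn_gt0//; lra.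
have r0 : 0 < r by rewrite sqrtr_gt0.
have rn : r ^+ 2 = n%:R by rewrite sqr_sqrtr// ltW.
have Lr : 4 * L <= r.
  rewrite -(@ler_pXn2r _ 2)// ?nnegrE; [|lra|exact: ltW].
  by rewrite rn exprMn; apply: le_trans Ln; rewrite ler_pM2r ?exprn_gt0//; lra.
pose l := L / r.
have l0 : 0 < l by rewrite divr_gt0//; lra.
have l4 : l <= 1 / 4 by rewrite ler_pdivrMr//; lra.
have ln : l ^+ 2 * n%:R = L ^+ 2 by rewrite -rn /l; field; rewrite gt_eqF.
pose Y B := expR (l * lin (fun=> 1) B).
pose y := expR (L ^+ 2 * a / 8).
pose z := expR (16 * L ^+ 2).
have YE k B : expR (lin (fun=> k * l) B) = expR (k * (l * lin (fun=> 1) B)).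
  by rewrite -!linZ; congr expR; apply: eq_bigr => i _; rewrite mulr1.
have EY : y <= Ex P Y.
  have -> : Ex P Y = Ex P (fun B => expR (lin (fun=> l) B)).
    by apply: eq_Ex => B; have := YE 1 B; rewrite !mul1r => ->.
  apply: le_trans (mgf_ge _); last by move=> i; rewrite gtr0_norm//; lra.
  rewrite ler_expR -ln -mulr_suml -mulr_sumr ler_pM2r; last lra.
  by rewrite -mulrA ler_wpM2l ?sqr_ge0// mulrC.
have EY2 : Ex P (fun B => Y B ^+ 2) <= z.
  have -> : Ex P (fun B => Y B ^+ 2) = Ex P (fun B => expR (lin (fun=> 2 * l) B)).
    by apply: eq_Ex => B; rewrite YE /Y -expRM_natl.
  apply: le_trans (mgf_le _) _.
    by move=> i; rewrite gtr0_norm; lra.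
  rewrite ler_expR sumr_const -mulr_natr -ln exprMn.
  have := ler_wpM2l (sqr_ge0 l) hI; lra.
pose th := expR (L * H).
have y0 : 0 < y := expR_gt0 _.
have z0 : 0 < z := expR_gt0 _.
have thy : th <= y / 4.
  rewrite ler_pdivlMr; last lra.
  have e4 : 4 <= expR 2 :> R by have := expR_ge_pow R 2; lra.
  apply: (@le_trans _ _ (th * expR 2)); first by rewrite ler_pM2l// expR_gt0.
  rewrite -expRD ler_expR.
  have -> : L ^+ 2 * a / 8 = L * (H + 2).
    by rewrite [in RHS]/L /L; field; rewrite gt_eqF.
  nra.
pose k := y / z.
have k0 : 0 < k by rewrite divr_gt0.
set p := Pr P _.
(* beyond the height, Y <= k / 2 Y^2 + 1 / (2 k); below it, Y <= th *)
have mix : Ex P Y <= th + k / 2 * z + (2 * k)^-1 * p.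
  have : Ex P Y <= Ex P (fun B => (th + k / 2 * Y B ^+ 2) +
    (2 * k)^-1 * (H * r <= lin (fun=> 1) B)%R%:R).
    apply: ler_Ex => B; case: (boolP (H * r <= _)) => h /=.
      have Y0 : 0 < th := expR_gt0 _.
      have : 0 <= k / 2 * (Y B - k^-1) ^+ 2.
        by rewrite mulr_ge0 ?sqr_ge0//; lra.
      have -> : k / 2 * (Y B - k^-1) ^+ 2 =
                k / 2 * Y B ^+ 2 - Y B + (2 * k)^-1.
        by field; rewrite gt_eqF.
      lra.
    rewrite mulr0 addr0 -[Y B]addr0 lerD//.
      rewrite -ltNge in h; rewrite ler_expR /l -mulrA ler_pM2l; last lra.
      by rewrite mulrC ler_pdivrMr//; exact: ltW.
    by rewrite mulr_ge0 ?sqr_ge0//; lra.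
  rewrite ExD ExD Ex_cst !ExZ => /le_trans; apply.
  by rewrite lerD2r lerD2l ler_wpM2l//; lra.
have kz : k * z = y by rewrite /k divfK ?gt_eqF.
have : y / 4 <= (2 * k)^-1 * p by lra.
rewrite -ler_pdivrMl ?invr_gt0; last lra.
rewrite invrK; apply: le_trans.
have -> : 2 * k * (y / 4) = (y * y) / z / 2 by rewrite /k; field; rewrite gt_eqF.
by rewrite /y /z -expRD -expRN -expRD ler_pM2r ?ler_expR; lra.
Qed.

End Bounded.
End RandomSubset.
(** * Hitting times of finite Markov chains *)

Section Hitting.
Variables (R : realType) (S : finType) (K : S -> S -> R).
Hypothesis K_ge0 : forall A B, 0 <= K A B.
Hypothesis K_sum : forall A, \sum_B K A B = 1.
Implicit Types (Z G U : pred S) (A B : S).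

(** The probability that the chain started at A does not visit Z at any of the
    times 0, ..., t. *)
Fixpoint miss Z (t : nat) A : R :=
  if Z A then 0
  else if t is t'.+1 then \sum_B K A B * miss Z t' B else 1.

Lemma miss_ge0 Z t A : 0 <= miss Z t A.
Proof.
elim: t A => [|t IH] A /=; case: ifP => // _.
by apply: sumr_ge0 => B _; rewrite mulr_ge0.
Qed.

Lemma miss_le1 Z t A : miss Z t A <= 1.
Proof.
elim: t A => [|t IH] A /=; case: ifP => // _.
by rewrite -(K_sum A); apply: ler_sum => B _; rewrite ler_piMr.
Qed.

Lemma miss_anti_t Z t A : miss Z t.+1 A <= miss Z t A.
Proof.
elim: t A => [|t IH] A; first by have := miss_le1 Z 1 A; rewrite /=; case: ifP.
have E k : miss Z k.+1 A = if Z A then 0 else \sum_B K A B * miss Z k B by [].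
rewrite (E t.+1) (E t); case: ifP => // _.
by apply: ler_sum => B _; rewrite ler_wpM2l.
Qed.

Lemma miss_anti Z s t A : (s <= t)%N -> miss Z t A <= miss Z s A.
Proof.
move=> /subnK <-; elim: (t - s)%N => // k IH.
exact: le_trans (miss_anti_t _ _ _) IH.
Qed.

(** The error e is only paid once, at the time when Z1 is reached. *)
Lemma miss_comp Z1 Z2 (e : R) s t : 0 <= e ->
  (forall A, Z1 A -> miss Z2 t A <= e) ->
  forall A, miss Z2 (s + t) A <= miss Z1 s A + e.
Proof.
move=> e0 h; elim: s => [|s IH] A.
  rewrite add0n [miss Z1 0 A]/=; case: ifP => ZA; first by rewrite add0r h.
  by rewrite -[leLHS]addr0 lerD ?miss_le1.
case: (boolP (Z1 A)) => Z1A.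
  have -> : miss Z1 s.+1 A = 0 by rewrite /= Z1A.
  rewrite add0r; apply: le_trans (h A Z1A); apply: miss_anti; exact: leq_addl.
rewrite addSn /= (negPf Z1A); case: ifP => _.
  by rewrite addr_ge0// sumr_ge0// => B _; rewrite mulr_ge0// miss_ge0.
rewrite -[e]mul1r -(K_sum A) mulr_suml -big_split/=.
by apply: ler_sum => B _; rewrite -mulrDr ler_wpM2l.
Qed.

(** As long as the target Z is avoided, the expectation of [phi] decreases
    geometrically while [phi] stays above m, so avoiding Z for long is unlikely.
    U A collects the moves from A that do not leave the region G where this
    holds; the probability e of the other moves is paid in every step. *)
Lemma miss_drift G Z (U : S -> pred S) (phi : S -> R) (l m e : R) :
  0 <= l -> 0 < m -> 0 <= e ->
  (forall A, 0 <= phi A) ->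
  (forall A, G A -> ~~ Z A -> m <= phi A) ->
  (forall A, G A -> ~~ Z A -> forall B, U A B -> G B || Z B) ->
  (forall A, G A -> ~~ Z A -> \sum_(B | ~~ U A B) K A B <= e) ->
  (forall A, G A -> ~~ Z A ->
     \sum_(B | U A B && ~~ Z B) K A B * phi B <= l * phi A) ->
  forall t A, G A -> miss Z t A <= l ^+ t * phi A / m + t%:R * e.
Proof.
move=> l0 m0 e0 phi0 hm hG hU hl; elim=> [|t IH] A GA /=; case: ifP => ZA.
- by rewrite expr0 mul1r mul0r addr0 divr_ge0 // ltW.
- by rewrite expr0 mul1r mul0r addr0 ler_pdivlMr// mul1r hm// ZA.
- by rewrite addr_ge0 ?mulr_ge0 ?divr_ge0 ?invr_ge0 ?exprn_ge0// ltW.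
have nZ : ~~ Z A by rewrite ZA.
rewrite (bigID (U A))/= addrC (_ : t.+1%:R * e = e + t%:R * e); last first.
  by rewrite -natr1 mulrDl mul1r addrC.
rewrite [leRHS]addrCA lerD//.
  apply: le_trans (hU A GA nZ); apply: ler_sum => B _.
  by rewrite ler_piMr// miss_le1.
rewrite (bigID Z)/= big1 ?add0r => [|B /andP[_ ZB]]; last first.
  by case: (t) => [|?]; rewrite /= ZB mulr0.
apply: (@le_trans _ _ (\sum_(B | U A B && ~~ Z B)
    (l ^+ t / m * (K A B * phi B) + t%:R * e * K A B))).
  apply: ler_sum => B /andP[UB ZB].
  have GB : G B by have := hG A GA nZ B UB; rewrite (negPf ZB) orbF.
  have := ler_wpM2l (K_ge0 A B) (IH B GB).
  by congr (_ <= _); ring.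
rewrite big_split/= -!mulr_sumr lerD//.
  apply: (@le_trans _ _ (l ^+ t / m * (l * phi A))).
    by rewrite ler_wpM2l ?divr_ge0 ?exprn_ge0 ?hl// ltW.
  by rewrite exprS le_eqVlt; apply/orP; left; apply/eqP; ring.
rewrite ler_piMr ?mulr_ge0//.
rewrite -(K_sum A) [leRHS](bigID (fun B => U A B && ~~ Z B))/= lerDl.
by apply: sumr_ge0 => B _.
Qed.

(** The case where [phi] decreases on all moves in U, not only on average. *)
Lemma miss_contract G Z (U : S -> pred S) (phi : S -> R) (l m e : R) :
  0 <= l -> 0 < m -> 0 <= e ->
  (forall A, 0 <= phi A) ->
  (forall A, G A -> ~~ Z A -> m <= phi A) ->
  (forall A, G A -> ~~ Z A -> \sum_(B | ~~ U A B) K A B <= e) ->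
  (forall A B, G A -> ~~ Z A -> U A B -> ~~ Z B ->
     G B /\ phi B <= l * phi A) ->
  forall t A, G A -> miss Z t A <= l ^+ t * phi A / m + t%:R * e.
Proof.
move=> l0 m0 e0 phi0 hm hU hG; apply: (miss_drift (U := U)) => //.
  move=> A GA nZ B UB; case: (boolP (Z B)) => [|nZB]; first by rewrite orbT.
  by have [-> _] := hG A B GA nZ UB nZB.
move=> A GA nZ.
apply: (@le_trans _ _ (\sum_(B | U A B && ~~ Z B) K A B * (l * phi A))).
  apply: ler_sum => B /andP[UB ZB]; apply: ler_wpM2l => //.
  by have [] := hG A B GA nZ UB ZB.
rewrite -mulr_suml ler_piMl ?mulr_ge0//.
rewrite -(K_sum A) [leRHS](bigID (fun B => U A B && ~~ Z B))/= lerDl.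
by apply: sumr_ge0.
Qed.

Lemma miss_sub Z1 Z2 t A : (forall B, Z1 B -> Z2 B) ->
  miss Z2 t A <= miss Z1 t A.
Proof.
move=> h; elim: t A => [|t IH] A /=.
  by case: ifP => // nZ2; case: ifP => // /h; rewrite nZ2.
case: ifP => nZ2; case: ifP => Z1A //.
- by apply: sumr_ge0 => B _; rewrite mulr_ge0 ?miss_ge0.
- by rewrite h in nZ2.
- by apply: ler_sum => B _; rewrite ler_wpM2l.
Qed.

Lemma miss_sym Z (f : S -> S) t A : involutive f ->
  (forall A B, K (f A) (f B) = K A B) -> (forall A, Z (f A) = Z A) ->
  miss Z t (f A) = miss Z t A.
Proof.
move=> fK hK hZ; elim: t A => [|t IH] A /=; rewrite hZ//.
case: ifP => // _; rewrite (reindex_inj (inv_inj fK))/=.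
by apply: eq_bigr => B _; rewrite hK IH.
Qed.

End Hitting.
(** * The voting process as a Markov chain *)

Section Voting.
Variables (R : realType) (V : finType) (G : {set {set V}}).
Implicit Types (A B : {set V}) (v : V).

(** The probability that a majority of three samples lies in a set containing
    a fraction x of the population. *)
Definition maj3 (x : R) : R := 3 * x ^+ 2 - 2 * x ^+ 3.

Definition frac A v : R :=
  #|neighbors G v :&: A|%:R / #|neighbors G v|%:R.

Definition adopt A v : R := maj3 (frac A v).

Lemma maj3_ge0 x : 0 <= x <= 1 -> 0 <= maj3 x <= 1.
Proof.
move=> /andP[x0 x1].
have -> : maj3 x = x ^+ 2 * (3 - 2 * x) by rewrite /maj3; ring.
have h0 : 0 <= x ^+ 2 * (3 - 2 * x) by rewrite mulr_ge0 ?sqr_ge0//; lra.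
rewrite h0 /= -subr_ge0.
have -> : 1 - x ^+ 2 * (3 - 2 * x) = (1 - x) ^+ 2 * (1 + 2 * x) by ring.
by rewrite mulr_ge0 ?sqr_ge0//; lra.
Qed.

Lemma maj3_comp x : maj3 (1 - x) = 1 - maj3 x.
Proof. by rewrite /maj3; ring. Qed.

Lemma frac01 A v : 0 <= frac A v <= 1.
Proof.
rewrite /frac divr_ge0//=.
have [->|d0] := eqVneq #|neighbors G v| 0; first by rewrite invr0 mulr0.
rewrite ler_pdivrMr ?ltr0n ?lt0n// mul1r ler_nat.
by rewrite subset_leq_card// subsetIl.
Qed.

Lemma adopt01 A v : 0 <= adopt A v <= 1.
Proof. exact: maj3_ge0 (frac01 A v). Qed.

Lemma natr_and (a b : bool) : (a && b)%:R = a%:R * b%:R :> R.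
Proof. by rewrite -mulnb natrM. Qed.

Lemma natr_forall (J : finType) (b : pred J) :
  [forall j, b j]%:R = \prod_j (b j)%:R :> R.
Proof.
rewrite -(big_andE xpredT).
by apply: (big_morph (fun b : bool => b%:R : R)) => //; exact: natr_and.
Qed.

Lemma sum_ffun3 (g0 g1 g2 : V -> R) :
  \sum_(t : {ffun 'I_3 -> V})
     g0 (t ord0) * g1 (t (lift ord0 ord0)) * g2 (t (lift ord0 (lift ord0 ord0)))
  = (\sum_u g0 u) * (\sum_u g1 u) * (\sum_u g2 u).
Proof.
have : \prod_(i < 3) \sum_u nth g0 [:: g0; g1; g2] i u =
  \sum_(t : {ffun 'I_3 -> V}) \prod_(i < 3) nth g0 [:: g0; g1; g2] i (t i).
  exact: bigA_distr_bigA.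
rewrite !big_ord_recl big_ord0 /= mulr1 mulrA => ->.
by apply: eq_bigr => t _; rewrite !big_ord_recl big_ord0 /= mulr1 mulrA.
Qed.

(** Each monomial is a product over the three samples, and sums over all samples
    of such products factor. *)
Lemma majority_poly A (t : {ffun 'I_3 -> V}) :
  let x i := (t i \in A)%:R : R in
  let i1 := lift ord0 ord0 in let i2 := lift ord0 (lift ord0 ord0) in
  (2 <= #|[set i | t i \in A]|)%N%:R =
  x ord0 * x i1 + x ord0 * x i2 + x i1 * x i2 - 2 * (x ord0 * x i1 * x i2) :> R.
Proof.
move=> /=; rewrite -sum1_card big_mkcond !big_ord_recl big_ord0 !inE.
by do 3!case: (_ \in A); rewrite /leq /=; ring.
Qed.

Definition valid_draw v (t : {ffun 'I_3 -> V}) : bool :=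
  [forall i, t i \in neighbors G v].

Lemma valid_drawE v t : (valid_draw v t)%:R =
  (t ord0 \in neighbors G v)%:R * (t (lift ord0 ord0) \in neighbors G v)%:R *
  (t (lift ord0 (lift ord0 ord0)) \in neighbors G v)%:R :> R.
Proof.
rewrite /valid_draw -(big_andE xpredT) !big_ord_recl big_ord0 andbT.
by rewrite -!mulnb !natrM mulrA.
Qed.

Lemma sum_mem A : \sum_u (u \in A)%:R = #|A|%:R :> R.
Proof. by rewrite -natr_sum -big_mkcond /= sum1_card. Qed.

Lemma sum_valid_draw v :
  \sum_t (valid_draw v t)%:R = #|neighbors G v|%:R ^+ 3 :> R.
Proof.
under eq_bigr do rewrite valid_drawE.
by rewrite (sum_ffun3 (fun u => (u \in neighbors G v)%:R)
  (fun u => (u \in neighbors G v)%:R)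
  (fun u => (u \in neighbors G v)%:R)) !sum_mem; ring.
Qed.

Lemma sum_majority A v : (0 < #|neighbors G v|)%N ->
  \sum_t (valid_draw v t)%:R * (2 <= #|[set i | t i \in A]|)%N%:R =
  #|neighbors G v|%:R ^+ 3 * adopt A v :> R.
Proof.
move=> d0; set N := neighbors G v.
pose gN u : R := (u \in N)%:R.
pose gA u : R := (u \in N :&: A)%:R.
have gE u : gN u * (u \in A)%:R = gA u.
  by rewrite /gA /gN in_setI natr_and.
have gI (u : V) : ((u \in N)%:R : R) = gN u by [].
have -> : \sum_t (valid_draw v t)%:R * (2 <= #|[set i | t i \in A]|)%N%:R =
  \sum_(t : {ffun 'I_3 -> V})
    (gA (t ord0) * gA (t (lift ord0 ord0)) * gN (t (lift ord0 (lift ord0 ord0)))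
   + gA (t ord0) * gN (t (lift ord0 ord0)) * gA (t (lift ord0 (lift ord0 ord0)))
   + gN (t ord0) * gA (t (lift ord0 ord0)) * gA (t (lift ord0 (lift ord0 ord0)))
   - 2 * (gA (t ord0) * gA (t (lift ord0 ord0)) *
          gA (t (lift ord0 (lift ord0 ord0))))) :> R.
  apply: eq_bigr => t _; rewrite valid_drawE majority_poly -!gE -/N.
  by rewrite !gI; ring.
rewrite sumrB !big_split/= -mulr_sumr !sum_ffun3 !sum_mem /adopt /maj3 /frac -/N.
have : #|N|%:R != 0 :> R by rewrite pnatr_eq0 -lt0n.
by move: (#|N|%:R) (#|N :&: A|%:R) => d a dn0; field.
Qed.

Lemma sum_sampling (h : V -> {ffun 'I_3 -> V} -> R) :
  \sum_(r : sampling V) \prod_v h v [ffun i => r (v, i)] =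
  \prod_v \sum_t h v t.
Proof.
rewrite bigA_distr_bigA.
rewrite (reindex (fun r : sampling V => [ffun v => [ffun i => r (v, i)]]))/=.
  by apply: eq_bigr => r _; apply: eq_bigr => v _; rewrite ffunE.
exists (fun f : {ffun V -> {ffun 'I_3 -> V}} => [ffun x => f x.1 x.2]).
  by move=> r _; apply/ffunP => -[v i]; rewrite !ffunE.
by move=> f _; apply/ffunP => v; apply/ffunP => i; rewrite !ffunE.
Qed.

Lemma valid_samplingE (r : sampling V) :
  (valid_sampling G r)%:R = \prod_v (valid_draw v [ffun i => r (v, i)])%:R :> R.
Proof.
rewrite -natr_forall; congr (nat_of_bool _)%:R; apply: eq_forallb => v.
by apply: eq_forallb => i; rewrite ffunE.
Qed.

Hypothesis deg_gt0 : forall v, (0 < #|neighbors G v|)%N.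

Definition nvalid : nat := #|[set r | valid_sampling G r]|.

Lemma nvalidE : nvalid%:R = \prod_v #|neighbors G v|%:R ^+ 3 :> R.
Proof.
rewrite /nvalid -sum1_card natr_sum.
under eq_bigl do rewrite inE.
rewrite big_mkcond/=.
transitivity (\sum_(r : sampling V) \prod_v (valid_draw v [ffun i => r (v, i)])%:R : R).
  by apply: eq_bigr => r _; rewrite -valid_samplingE; case: valid_sampling.
rewrite (sum_sampling (fun v t => (valid_draw v t)%:R)).
by apply: eq_bigr => v _; rewrite sum_valid_draw.
Qed.

Lemma nvalid_gt0 : 0 < nvalid%:R :> R.
Proof. by rewrite nvalidE prodr_gt0// => v _; rewrite exprn_gt0// ltr0n. Qed.

(** After one round the opinion set is a product random set: the vertices adopt
    opinion 1 independently, v with probability [adopt A v]. *)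
Lemma step_law A (phi : {set V} -> R) :
  \sum_(r | valid_sampling G r) phi (best_of_three A r) =
  nvalid%:R * Ex (adopt A) phi.
Proof.
have count B : \sum_(r | valid_sampling G r && (best_of_three A r == B)) 1 =
    nvalid%:R * bern (adopt A) B :> R.
  pose h v (t : {ffun 'I_3 -> V}) : R := (valid_draw v t)%:R *
    ((2 <= #|[set i | t i \in A]|)%N == (v \in B))%:R.
  have hE (r : sampling V) : \prod_v h v [ffun i => r (v, i)] =
      (valid_sampling G r && (best_of_three A r == B))%:R.
    rewrite big_split/= -valid_samplingE -mulnb natrM; congr (_ * _).
    rewrite -natr_forall; congr (nat_of_bool _)%:R.
      apply/forallP/eqP => [hB|<- v].
        apply/setP => v; rewrite inE -(eqP (hB v)); congr (_ <= #|pred_of_set _|)%N.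
        by apply/setP => i; rewrite !inE ffunE.
      rewrite inE; apply/eqP; congr (_ <= #|pred_of_set _|)%N.
      by apply/setP => i; rewrite !inE ffunE.
  rewrite big_mkcond/=.
  transitivity (\sum_(r : sampling V) \prod_v h v [ffun i => r (v, i)]).
    by apply: eq_bigr => r _; rewrite hE; case: (_ && _).
  rewrite sum_sampling nvalidE /bern -big_split/=; apply: eq_bigr => v _.
  have sm := sum_majority A (deg_gt0 v).
  rewrite /h; case: (v \in B).
    by rewrite -sm; apply: eq_bigr => t _; rewrite eqb_id.
  rewrite mulrBr mulr1 -sm -sum_valid_draw -sumrB; apply: eq_bigr => t _.
  by case: (2 <= _)%N; rewrite /=; ring.
rewrite (partition_big (best_of_three A) predT)//= /Ex mulr_sumr.
apply: eq_bigr => B _; rewrite mulrA -count mulr_suml.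
by apply: eq_bigr => r /andP[_ /eqP ->]; rewrite mul1r.
Qed.

Definition kernel A B : R := bern (adopt A) B.

Lemma kernel_ge0 A B : 0 <= kernel A B.
Proof. exact: bern_ge0 (adopt01 A) B. Qed.

Lemma kernel_sum A : \sum_B kernel A B = 1.
Proof.
by rewrite -(Ex_cst (adopt A) 1); apply: eq_bigr => B _; rewrite mulr1.
Qed.

Lemma sum_tuple_cons (T : nat) (F : T.+1.-tuple (sampling V) -> R) :
  \sum_s F s = \sum_r \sum_(s : T.-tuple (sampling V)) F (cons_tuple r s).
Proof.
rewrite pair_big/= (reindex (fun x => cons_tuple x.1 x.2))//=.
exists (fun s : T.+1.-tuple _ => (thead s, behead_tuple s)).
  by move=> [r s] _ /=; congr pair; apply: val_inj.
by move=> s _ /=; rewrite [RHS]tuple_eta.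
Qed.

Lemma sum_all_valid (T : nat) (F : T.+1.-tuple (sampling V) -> R) :
  \sum_(s : T.+1.-tuple (sampling V) | all (valid_sampling G) s) F s =
  \sum_(r | valid_sampling G r)
    \sum_(s : T.-tuple (sampling V) | all (valid_sampling G) s) F (cons_tuple r s).
Proof.
rewrite big_mkcond sum_tuple_cons [RHS]big_mkcond/=; apply: eq_bigr => r _.
case: (valid_sampling G r); last by rewrite big1.
by rewrite [RHS]big_mkcond.
Qed.

Lemma count_all_valid (T : nat) :
  \sum_(s : T.-tuple (sampling V) | all (valid_sampling G) s) 1 =
  nvalid%:R ^+ T :> R.
Proof.
elim: T => [|T IH].
  rewrite (eq_bigl xpredT); first by rewrite sumr_const card_tuple expn0 expr0.
  by move=> s; rewrite tuple0.
rewrite sum_all_valid; under eq_bigr do rewrite IH.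
by rewrite sumr_const exprS /nvalid cardsE mulr_natl.
Qed.

(** Conditioning on the first round: its law is [step_law], and the remaining
    rounds are a shorter sequence started from the new opinion set. *)
Lemma sum_Tcons (T m : nat) A : (m <= T)%N ->
  \sum_(s : T.-tuple (sampling V) | all (valid_sampling G) s)
     (m < Tcons A s)%N%:R =
  nvalid%:R ^+ T * miss kernel (@consensus V) m A :> R.
Proof.
elim: T m A => [|T IH] m A.
  rewrite leqn0 => /eqP ->; rewrite -count_all_valid mulr_suml.
  apply: eq_bigr => s _; rewrite tuple0 /Tcons /= mul1r.
  by case: consensus.
case: m => [_|m mT].
  rewrite -count_all_valid mulr_suml; apply: eq_bigr => s _.
  by rewrite /Tcons /= mul1r; case: consensus.
have TE r (s : T.-tuple (sampling V)) :
    (m.+1 < Tcons A (cons_tuple r s))%N =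
    ~~ consensus A && (m < Tcons (best_of_three A r) s)%N.
  by rewrite /Tcons /=; case: consensus.
rewrite sum_all_valid /=; case: ifP => cA.
  by rewrite mulr0 big1// => r _; rewrite big1// => s _; rewrite TE cA.
transitivity (\sum_(r | valid_sampling G r) nvalid%:R ^+ T *
     miss kernel (@consensus V) m (best_of_three A r)).
  by apply: eq_bigr => r _; rewrite -IH//; apply: eq_bigr => s _; rewrite TE cA.
rewrite -mulr_sumr (step_law A (miss kernel (@consensus V) m)).
by rewrite exprSr -mulrA.
Qed.

Lemma vote_Pr_ge (T m : nat) A (E : pred (T.-tuple (sampling V))) :
  (m <= T)%N -> (forall s, (Tcons A s <= m)%N -> E s) ->
  1 - miss kernel (@consensus V) m A <= vote_Pr G R E.
Proof.
move=> mT hE; have N0 : 0 < nvalid%:R ^+ T :> R by rewrite exprn_gt0// nvalid_gt0.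
have den : #|[set s : T.-tuple (sampling V) | all (valid_sampling G) s]|%:R =
    nvalid%:R ^+ T :> R.
  by rewrite -count_all_valid sumr_const cardsE.
rewrite /vote_Pr den ler_pdivlMr// mulrBl mul1r mulrC -sum_Tcons//.
rewrite -count_all_valid -sumrB -sum1_card natr_sum.
under [leRHS]eq_bigl do rewrite inE.
rewrite big_mkcondr/=; apply: ler_sum => s _.
have := hE s; case: ltnP => [_ _|_ ->//]; last by rewrite subr0.
by rewrite subrr; case: ifP.
Qed.

End Voting.
(** * Typical block-model graphs *)

Section TypicalGraph.
Variables (R : realType) (n : nat) (p q : R).
Hypotheses (q_gt0 : 0 < q) (q_le_p : q <= p) (p_le1 : p <= 1).
Notation V := (sbm_vertex n).
Implicit Types (G : {set {set V}}) (A S : {set V}) (u v : V) (c : V * V -> R).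

(** Extending the edge probabilities by 0 to all vertex sets makes the random
    graph a random subset of the type of all vertex sets. *)
Definition set_prob (e : {set V}) : R :=
  if e \in vpairs V then edge_prob p q e else 0.

Lemma set_prob01 e : 0 <= set_prob e <= 1.
Proof.
move: (q_gt0) (q_le_p) (p_le1) => q0 qp p1.
rewrite /set_prob /edge_prob; case: ifP => _; last by rewrite lexx ler01.
by case: ifP => _; apply/andP; split; lra.
Qed.

Lemma sbm_Pr_ge (Q : {set {set V}} -> Prop) (bad : pred {set {set V}}) :
  (forall G, G \subset vpairs V -> ~~ bad G -> Q G) ->
  1 - Pr set_prob bad <= sbm_Pr p q Q.
Proof.
move=> hQ; rewrite -Pr_not /Pr /Ex /sbm_Pr [leRHS]big_mkcond/=.
apply: ler_sum => G _; have b0 := bern_ge0 set_prob01 G.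
have w0 : 0 <= sbm_weight p q G.
  apply: prodr_ge0 => e ev; have := set_prob01 e.
  by rewrite /set_prob ev => /andP[? ?]; case: ifP => _; lra.
rewrite powersetE; case: (boolP (G \subset vpairs V)) => [sG|nsG] /=; last first.
  suff -> : bern set_prob G = 0 by rewrite mul0r.
  have /subsetPn[e eG eV] := nsG.
  by rewrite /bern (bigD1 e)//= eG /set_prob (negPf eV) mul0r.
have -> : bern set_prob G = sbm_weight p q G.
  rewrite /bern /sbm_weight [RHS]big_mkcond/=; apply: eq_bigr => e _.
  rewrite /set_prob; case: (boolP (e \in vpairs V)) => // ne.
  case: ifP => eG; last by rewrite subr0.
  by rewrite (subsetP sG e eG) in ne.
case: (boolP (bad G)) => bG /=; first by rewrite mulr0; case: ifP.
by rewrite mulr1 asboolT//; exact: hQ.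
Qed.

Definition pair_prob v u : R := if v.1 == u.1 then p else q.

Lemma pair_prob01 v u : q <= pair_prob v u <= 1.
Proof.
move: (q_gt0) (q_le_p) (p_le1) => q0 qp p1.
by rewrite /pair_prob; case: ifP => _; apply/andP; split; lra.
Qed.

Lemma edge_prob_pair v u : edge_prob p q [set v; u] = pair_prob v u.
Proof.
rewrite /edge_prob /pair_prob; congr (if _ then p else q).
apply/forall_inP/eqP => [/(_ v)|vu a].
  rewrite !inE eqxx => /(_ isT)/forall_inP/(_ u).
  by rewrite !inE eqxx orbT => /(_ isT)/eqP.
rewrite !inE => av; apply/forall_inP => b; rewrite !inE => bv.
by case/orP: av => /eqP ->; case/orP: bv => /eqP ->; rewrite ?vu.
Qed.

(** Pairs are ordered, so an edge contributes through both orientations, and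
    the diagonal, which carries no edge, is left out. *)
Definition wdisc c G : R := \sum_(x | x.1 != x.2)
  c x * ((x.2 \in neighbors G x.1)%:R - pair_prob x.1 x.2).

Definition edge_coef c (e : {set V}) : R :=
  \sum_(x : V * V | (x.1 != x.2) && ([set x.1; x.2] == e)) c x.

Lemma wdisc_lin c G : wdisc c G = lin set_prob (edge_coef c) G.
Proof.
rewrite /wdisc (partition_big (fun x : V * V => [set x.1; x.2]) predT)//=.
apply: eq_bigr => e _; rewrite /edge_coef mulr_suml.
apply: eq_bigr => x /andP[nx /eqP <-].
by rewrite /set_prob !inE cards2 nx /= edge_prob_pair.
Qed.

Lemma card_orientations (e : {set V}) :
  (#|[set x : V * V | (x.1 != x.2) && ([set x.1; x.2] == e)]| <= 2)%N.
Proof.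
set D := [set x | _].
have [->|[[a b]]] := set_0Vmem D; first by rewrite cards0.
rewrite inE /= => /andP[ab /eqP eab].
apply: (@leq_trans #|[set (a, b); (b, a)]|); last by rewrite cards2; case: eqP.
apply: subset_leq_card; apply/subsetP => -[u v]; rewrite !inE /= -eab.
move=> /andP[uv /eqP E].
have : u \in [set a; b] by rewrite -E !inE eqxx.
have : v \in [set a; b] by rewrite -E !inE eqxx orbT.
rewrite !inE !xpair_eqE => /orP[] /eqP ev /orP[] /eqP eu; subst;
  by rewrite ?eqxx ?orbT // in uv *.
Qed.

(** Each coefficient in terms of edges is at most 2, whence the sum of their
    squares is at most twice the sum of the absolute values. *)
Lemma wdisc_tail c (l t s : R) : (forall x, `|c x| <= 1) ->
  0 <= l <= 1 / 4 -> \sum_x `|c x| <= s ->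
  Pr set_prob (fun G => t <= wdisc c G) <= expR (4 * l ^+ 2 * s - l * t).
Proof.
move=> hc /andP[l0 l4] hs.
have C2 e : `|edge_coef c e| <= 2.
  apply: le_trans (ler_norm_sum _ _ _) _.
  apply: (@le_trans _ _ (\sum_(x : V * V | (x.1 != x.2) && ([set x.1; x.2] == e)) 1)).
    by apply: ler_sum.
  by rewrite sumr_const -cardsE ler_nat card_orientations.
apply: le_trans (_ : Pr set_prob (fun G => t <= lin set_prob (edge_coef c) G) <= _).
  by apply: Pr_le => [|G]; rewrite ?wdisc_lin//; exact: set_prob01.
apply: le_trans (tail_le set_prob01 _ l0 _) _.
  by move=> e; rewrite normrM ger0_norm//; have := ler_pM l0 (normr_ge0 _) l4 (C2 e); lra.
rewrite ler_expR lerD2r.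
have -> : 4 * l ^+ 2 * s = 2 * l ^+ 2 * (2 * s) by ring.
rewrite ler_wpM2l ?mulr_ge0 ?sqr_ge0//.
apply: (@le_trans _ _ (\sum_e 2 * `|edge_coef c e|)).
  apply: ler_sum => e _; rewrite -real_normK ?num_real// expr2.
  by rewrite ler_wpM2r.
rewrite -mulr_sumr ler_wpM2l//; apply: le_trans hs.
apply: (@le_trans _ _ (\sum_(x : V * V | x.1 != x.2) `|c x|)); last first.
  by rewrite [leRHS](bigID (fun x => x.1 != x.2))/= lerDl sumr_ge0.
rewrite [leRHS](partition_big (fun x : V * V => [set x.1; x.2]) predT)//=.
by apply: ler_sum => e _; exact: ler_norm_sum.
Qed.

Definition disc G v A : R :=
  #|neighbors G v :&: A|%:R - \sum_(u in A) pair_prob v u.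

(** The discrepancies are measured in l^1 over the vertices because the adoption
    probabilities are Lipschitz functions of the neighbourhood fractions. *)
Definition typical (d K : R) G : Prop :=
  (forall v, d * n%:R <= #|neighbors G v|%:R) /\
  (forall A, \sum_v `|disc G v A| <= K * (n%:R * Num.sqrt n%:R)).

Definition sparse_vertex v G : bool := #|neighbors G v|%:R < q / 2 * n%:R.

Definition sgn S v : R := if v \in S then 1 else - 1.

Definition cut_coef A S (x : V * V) : R := sgn S x.1 * (x.2 \in A)%:R.

Definition large_cut A S G : bool :=
  21 * (n%:R * Num.sqrt n%:R) <= wdisc (cut_coef A S) G.

Lemma card_V : #|{: V}| = (2 * n)%N.
Proof. by rewrite card_prod card_bool card_ord. Qed.

Lemma sgn_norm S v : `|sgn S v| = 1.
Proof. by rewrite /sgn; case: ifP; rewrite ?normrN normr1. Qed.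

Lemma discE G v A :
  disc G v A = \sum_(u in A) ((u \in neighbors G v)%:R - pair_prob v u).
Proof.
rewrite sumrB /disc; congr (_ - _).
rewrite -(sum_mem R) big_mkcond [RHS]big_mkcond/=; apply: eq_bigr => u _.
by rewrite inE; case: (u \in A); rewrite ?andbT ?andbF.
Qed.

(** With the signs S of the discrepancies, their l^1 norm is the weighted
    discrepancy [wdisc (cut_coef A S)], up to the diagonal, which contributes at
    most 2 n. *)
Lemma typicalP G : (0 < n)%N ->
  ~~ ([exists v, sparse_vertex v G] ||
      [exists AS : {set V} * {set V}, large_cut AS.1 AS.2 G]) ->
  typical (q / 2) 23 G.
Proof.
move=> n0; rewrite negb_or !negb_exists => /andP[/forallP h1 /forallP h2]; split.
  by move=> v; have := h1 v; rewrite /sparse_vertex -leNgt.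
move=> A; pose S := [set v | 0 <= disc G v A].
have -> : \sum_v `|disc G v A| = \sum_v sgn S v * disc G v A.
  apply: eq_bigr => v _; rewrite /sgn inE.
  case: (boolP (0 <= disc G v A)) => h; first by rewrite mul1r ger0_norm.
  by rewrite mulN1r ltr0_norm// ltNge.
have -> : \sum_v sgn S v * disc G v A =
    wdisc (cut_coef A S) G +
    \sum_v cut_coef A S (v, v) * ((v \in neighbors G v)%:R - pair_prob v v).
  transitivity (\sum_v \sum_u cut_coef A S (v, u) *
       ((u \in neighbors G v)%:R - pair_prob v u)).
    apply: eq_bigr => v _; rewrite discE mulr_sumr big_mkcond/=.
    apply: eq_bigr => u _; rewrite /cut_coef /=.
    by case: (u \in A); rewrite ?mulr1 ?mulr0 ?mul0r.
  rewrite /wdisc pair_big/= (bigID (fun x => x.1 != x.2))/=; congr (_ + _).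
  rewrite (reindex_onto (fun v => (v, v)) (fun x => x.1))/=.
    by apply: eq_bigl => v; rewrite !eqxx.
  by move=> [u v] /=; rewrite negbK => /eqP ->.
have r1 : 1 <= Num.sqrt n%:R :> R by rewrite -[leLHS]sqrtr1 ler_wsqrtr// ler1n.
have -> : 23 * (n%:R * Num.sqrt n%:R) =
  21 * (n%:R * Num.sqrt n%:R) + 2 * (n%:R * Num.sqrt n%:R) :> R by ring.
have n1 : 1 <= n%:R :> R by rewrite ler1n.
apply: lerD.
  by have := h2 (A, S); rewrite /large_cut /= -ltNge => /ltW.
apply: (@le_trans _ _ (\sum_(v : V) 1)).
  apply: ler_sum => v _; apply: le_trans (ler_norm _) _.
  rewrite /cut_coef !normrM sgn_norm mul1r /=.
  have h : `|(v \in neighbors G v)%:R - pair_prob v v| <= 1.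
    have /andP[] := pair_prob01 v v; move: (q_gt0); move: (pair_prob v v) => x.
    move=> q0 qx x1; rewrite ler_norml.
    by case: (_ \in _); rewrite ?mulr1n ?mulr0n; apply/andP; split; lra.
  by case: (v \in A); rewrite ?normr1 ?normr0 ?mul1r ?mul0r.
rewrite sumr_const card_V natrM; nra.
Qed.

(** The expected degree is at least q n, so a degree below q n / 2 is a linear
    deviation of a sum of 2 n - 1 independent variables. *)
Lemma sparse_vertex_Pr v : (0 < n)%N ->
  Pr set_prob (sparse_vertex v) <= expR (- (q ^+ 2 * n%:R / 128)).
Proof.
move=> n0; have n1 : 1 <= n%:R :> R by rewrite ler1n.
pose c (x : V * V) : R := - (x.1 == v)%:R.
have -> : - (q ^+ 2 * n%:R / 128) =
    4 * (q / 32) ^+ 2 * (2 * n%:R) - q / 32 * (q / 2 * n%:R) by field.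
suff : Pr set_prob (sparse_vertex v) <=
    Pr set_prob (fun G => q / 2 * n%:R <= wdisc c G).
  move/le_trans; apply; apply: wdisc_tail => //.
- by move=> x; rewrite normrN ger0_norm// lern1 leq_b1.
- by move: (q_gt0) (q_le_p) (p_le1) => q0 qp p1; apply/andP; split; lra.
- rewrite -natrM -card_V -sum1_card natr_sum.
  rewrite -(pair_big predT predT (fun a b => `|c (a, b)|))/= exchange_big/=.
  apply: ler_sum => u _; rewrite (bigD1 v)//= big1 ?addr0.
    by rewrite /c /= eqxx normrN normr1.
  by move=> w /negPf wv; rewrite /c /= wv oppr0 normr0.
apply: Pr_le => [|G]; first exact: set_prob01.
rewrite /sparse_vertex => h.
have -> : wdisc c G = \sum_(u | v != u) pair_prob v u -
                    \sum_(u | v != u) (u \in neighbors G v)%:R.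
  rewrite /wdisc -sumrB (bigID (fun x : V * V => x.1 == v))/= [X in _ + X]big1.
    rewrite addr0 (reindex_onto (fun u => (v, u)) (fun x => x.2))/=.
      apply: eq_big => [u|u _]; first by rewrite !eqxx !andbT.
      by rewrite /c /= eqxx mulN1r opprB.
    by move=> [a b] /= /andP[_ /eqP ->].
  by move=> x /andP[_ /negPf xv]; rewrite /c xv oppr0 mul0r.
have s1 : \sum_(u : V | v != u) (u \in neighbors G v)%:R <= #|neighbors G v|%:R :> R.
  by rewrite -(sum_mem R) [leRHS](bigID (fun u => v != u))/= lerDl sumr_ge0.
have s2 : n%:R * q <= \sum_(u | v != u) pair_prob v u.
  apply: (@le_trans _ _ (\sum_(u | v != u) q)).
    rewrite sumr_const -[leRHS]mulr_natl ler_pM2r// ler_nat.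
    have := cardC1 v; rewrite card_V => E.
    have -> : #|[pred u | v != u]| = (2 * n).-1.
      by rewrite -E; apply: eq_card => u; rewrite !inE eq_sym.
    by lia.
  by apply: ler_sum => u _; have /andP[] := pair_prob01 v u.
lra.
Qed.

(** The parameter 1 / sqrt n gives the exponent 16 n - 21 n; the rate 5 n
    exceeds the logarithm of the number 16^n of pairs (A, S). *)
Lemma large_cut_Pr A S : (16 <= n)%N ->
  Pr set_prob (large_cut A S) <= expR (- (5 * n%:R)).
Proof.
move=> n16; pose r : R := Num.sqrt n%:R.
have n0 : 16 <= n%:R :> R by rewrite ler_nat.
have r0 : 0 < r by rewrite sqrtr_gt0; lra.
have rn : n%:R = r ^+ 2 by rewrite sqr_sqrtr//; lra.
have r4 : 4 <= r.
  rewrite -(@ler_pXn2r _ 2)// ?nnegrE; [|lra|exact: ltW].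
  by rewrite -rn; apply: le_trans n0; lra.
have -> : - (5 * n%:R) = 4 * r^-1 ^+ 2 * (4 * n%:R ^+ 2) -
            r^-1 * (21 * (n%:R * r)).
  by rewrite rn; field; rewrite gt_eqF.
apply: wdisc_tail.
- by move=> x; rewrite normrM sgn_norm mul1r ger0_norm// lern1 leq_b1.
- by rewrite invr_ge0 (ltW r0)/= -div1r ler_pdivrMr//; lra.
- apply: (@le_trans _ _ (\sum_(x : V * V) 1)).
    by apply: ler_sum => x _; rewrite normrM sgn_norm mul1r ger0_norm// lern1 leq_b1.
  by rewrite sumr_const card_prod card_V -natrX -natrM ler_nat; lia.
Qed.

Lemma typical_whp : (16 <= n)%N ->
  let Cg := 27 + 54 * 128 ^+ 3 / q ^+ 6 in
  forall Q : {set {set V}} -> Prop,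
  (forall G, G \subset vpairs V -> typical (q / 2) 23 G -> Q G) ->
  1 - Cg / n%:R ^+ 2 <= sbm_Pr p q Q.
Proof.
move=> n16 Cg Q hQ.
have n0 : (0 < n)%N by apply: leq_trans n16.
apply: le_trans (sbm_Pr_ge (fun G sG nb => hQ G sG (typicalP n0 nb))).
rewrite lerD2l lerN2; apply: le_trans (Pr_or set_prob01 _ _) _.
have nR : 1 <= n%:R :> R by rewrite ler1n.
have nR0 : 0 < n%:R :> R by lra.
have -> : Cg / n%:R ^+ 2 = 54 * 128 ^+ 3 / q ^+ 6 / n%:R ^+ 2 + 27 / n%:R ^+ 2.
  by rewrite /Cg mulrDl addrC.
apply: lerD.
  apply: le_trans (Pr_exists set_prob01 _) _.
  apply: (@le_trans _ _ (\sum_(v : V) (27 * 128 ^+ 3 / q ^+ 6 / n%:R ^+ 3))).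
    apply: ler_sum => v _; apply: le_trans (sparse_vertex_Pr v n0) _.
    apply: le_trans (expRN_le_inv3 _) _.
      by rewrite divr_gt0 ?mulr_gt0 ?exprn_gt0//.
    rewrite le_eqVlt; apply/orP; left; apply/eqP.
    by field; rewrite !gt_eqF.
  rewrite sumr_const card_V -[leLHS]mulr_natl natrM le_eqVlt; apply/orP; left; apply/eqP.
  by field; rewrite !gt_eqF.
apply: le_trans (Pr_exists set_prob01 _) _.
apply: (@le_trans _ _ (\sum_(AS : {set V} * {set V}) expR (- (5 * n%:R)))).
  by apply: ler_sum => AS _; exact: large_cut_Pr.
have cS : #|{: {set V}}| = (2 ^ (2 * n))%N.
  by rewrite -cardsT -powersetT card_powerset cardsT card_V.
rewrite sumr_const card_prod cS -[leLHS]mulr_natl.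
apply: (@le_trans _ _ (expR (- n%:R))); last first.
  apply: le_trans (expRN_le_inv3 nR0) _.
  rewrite ler_pM2l; last lra.
  rewrite lef_pV2 ?posrE ?exprn_gt0//.
  by rewrite [leRHS]exprS ler_peMl// exprn_ge0// ltW.
have -> : - n%:R = (4 * n)%:R - 5 * n%:R :> R by rewrite natrM; ring.
rewrite expRD ler_pM2r ?expR_gt0//.
apply: le_trans (expR_ge_pow R (4 * n)).
by rewrite -expnD natrX ler_weXn2l ?ler1n//; lia.
Qed.

End TypicalGraph.
(** * The mean-field map *)

Section MeanField.
Variable R : realType.
Implicit Types (a w u e k : R).

(** The mean-field maps of alpha and, up to the factor u, of w. *)
Definition drift_sum a w : R := a * (3 - a ^+ 2 - 3 * w ^+ 2) / 2.

Definition drift_diff a w : R := w * (3 - 3 * a ^+ 2 - w ^+ 2) / 2.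

Lemma maj3_sum a w :
  maj3 ((1 + a + w) / 2) + maj3 ((1 + a - w) / 2) = 1 + drift_sum a w.
Proof. by rewrite /maj3 /drift_sum; field. Qed.

Lemma maj3_diff a w :
  maj3 ((1 + a + w) / 2) - maj3 ((1 + a - w) / 2) = drift_diff a w.
Proof. by rewrite /maj3 /drift_diff; field. Qed.

Lemma maj3_lipschitz (x y : R) : 0 <= x <= 1 -> 0 <= y <= 1 ->
  `|maj3 x - maj3 y| <= 2 * `|x - y|.
Proof.
move=> /andP[x0 x1] /andP[y0 y1].
have -> : maj3 x - maj3 y =
    (3 * (x + y) - 2 * (x ^+ 2 + x * y + y ^+ 2)) * (x - y).
  by rewrite /maj3; ring.
rewrite normrM ler_wpM2r// ler_norml; apply/andP; split.
  have : 0 <= x * (1 - x) by rewrite mulr_ge0//; lra.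
  have : 0 <= y * (1 - y) by rewrite mulr_ge0//; lra.
  have : 0 <= x * (1 - y) by rewrite mulr_ge0//; lra.
  have : 0 <= y * (1 - x) by rewrite mulr_ge0//; lra.
  lra.
have := sqr_ge0 (x - y); have := sqr_ge0 (x + y - 1); lra.
Qed.

(** The product of the two probabilities is x^2 (1 - x)^2 (3 + 4 x (1 - x)). *)
Lemma maj3_var (x : R) : `|2 * x - 1| <= 5 / 6 ->
  1 / 64 <= maj3 x * (1 - maj3 x).
Proof.
rewrite ler_norml => /andP[h1 h2].
have -> : maj3 x * (1 - maj3 x) =
    (x * (1 - x)) ^+ 2 * (3 + 4 * (x * (1 - x))) by rewrite /maj3; ring.
have h3 : 11 / 144 <= x * (1 - x).
  have : 0 <= (5 / 6 - (2 * x - 1)) * (5 / 6 + (2 * x - 1)).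
    by rewrite mulr_ge0//; lra.
  lra.
have h4 : (11 / 144) ^+ 2 <= (x * (1 - x)) ^+ 2.
  by rewrite lerXn2r ?nnegrE//; lra.
have : 0 <= ((x * (1 - x)) ^+ 2 - (11 / 144) ^+ 2) * (3 + 4 * (x * (1 - x))).
  by rewrite mulr_ge0//; lra.
lra.
Qed.

Lemma ler_half (x y : R) : (x / 2 <= y / 2) = (x <= y).
Proof. by rewrite ler_pM2r// invr_gt0. Qed.

Lemma sqr_sum_le1 a w : `|a| + `|w| <= 1 -> a ^+ 2 + w ^+ 2 <= 1.
Proof.
rewrite -(real_normK (num_real a)) -(real_normK (num_real w)).
have := normr_ge0 a; have := normr_ge0 w.
by move: `|a| `|w| => x y; nra.
Qed.

Lemma drift_diff_le a w : `|a| + `|w| <= 1 ->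
  `|drift_diff a w| <= `|w| * (3 - 3 * `|a| ^+ 2 - `|w| ^+ 2) / 2.
Proof.
move=> /sqr_sum_le1 h; rewrite /drift_diff !real_normK ?num_real//.
rewrite normrM [`|_^-1|]ger0_norm; last lra.
by rewrite normrM [`|3 - _ - _|]ger0_norm//; have := sqr_ge0 w; lra.
Qed.

Lemma drift_sum_abs a w : `|a| + `|w| <= 1 ->
  `|drift_sum a w| = `|a| * (3 - `|a| ^+ 2 - 3 * `|w| ^+ 2) / 2.
Proof.
move=> /sqr_sum_le1 h; rewrite /drift_sum !real_normK ?num_real//.
rewrite normrM [`|_^-1|]ger0_norm; last lra.
rewrite normrM [`|3 - _ - _|]ger0_norm//.
by have := sqr_ge0 a; have := sqr_ge0 w; lra.
Qed.

(** For u < 3/4 the value of w0^2 lies strictly between the fixed point 3 - 2 / u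
    of the axis a = 0 and the value 1/3 below which the axis repels; the factor
    by which a grows there is at least 1 + [eta]. *)
Definition w0 u : R := Num.sqrt ((1 + 4 * u) / 12).

Definition eta u : R := (3 - 4 * u) / 16.

Section Thresholds.
Variable u : R.
Hypothesis u_bounds : 0 <= u < 3 / 4.

Lemma w0_sqr : w0 u ^+ 2 = (1 + 4 * u) / 12.
Proof. by move: (u_bounds) => /andP[? ?]; rewrite sqr_sqrtr//; lra. Qed.

Lemma w0_gt0 : 0 < w0 u.
Proof. by move: (u_bounds) => /andP[? ?]; rewrite sqrtr_gt0; lra. Qed.

Lemma w0_le : w0 u <= 7 / 12.
Proof.
rewrite -(@ler_pXn2r _ 2)// ?nnegrE ?ltW ?w0_gt0//.
  by rewrite w0_sqr; move: (u_bounds) => /andP[? ?]; lra.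
by lra.
Qed.

Lemma eta_bounds : 0 < eta u <= 3 / 16.
Proof.
by move: (u_bounds) => /andP[? ?]; rewrite /eta; apply/andP; split; lra.
Qed.

Lemma eta_w0 : 1 - 3 * w0 u ^+ 2 = 4 * eta u.
Proof. by rewrite w0_sqr /eta; lra. Qed.

Definition diff_rate : R := u * (3 - w0 u ^+ 2) / 2.

Lemma diff_rate_bounds : 0 <= diff_rate < 1.
Proof.
rewrite /diff_rate w0_sqr; move: (u_bounds) => /andP[? ?].
by apply/andP; split; nra.
Qed.

Lemma diff_contracts a w w' e : `|a| + `|w| <= 1 -> w0 u <= `|w| ->
  `|w' - u * drift_diff a w| <= e -> e <= (1 - diff_rate) / 2 * w0 u ->
  `|w'| <= (1 + diff_rate) / 2 * `|w|.
Proof.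
move=> hd hw he e1; have h := drift_diff_le hd.
have /andP[l0 l1] := diff_rate_bounds; have w00 := w0_gt0.
move: (u_bounds) => /andP[u0 u1].
have h2 : `|w'| <= e + u * `|drift_diff a w|.
  rewrite -(ger0_norm u0) -normrM -lerBlDr.
  by apply: le_trans (lerB_dist _ _) he.
have a2 := sqr_ge0 (`|a|).
have h3 : u * `|drift_diff a w| <= diff_rate * `|w|.
  have -> : diff_rate * `|w| = u * (`|w| * (3 - w0 u ^+ 2) / 2).
    by rewrite /diff_rate; ring.
  rewrite ler_wpM2l//; apply: le_trans h _.
  rewrite ler_half ler_wpM2l//.
  have : w0 u ^+ 2 <= `|w| ^+ 2 by rewrite lerXn2r ?nnegrE// ltW.
  lra.
have : 0 <= (1 - diff_rate) * (`|w| - w0 u) by rewrite mulr_ge0//; lra.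
lra.
Qed.

Lemma diff_stays a w w' e : `|a| + `|w| <= 1 -> `|w| <= w0 u ->
  `|w' - u * drift_diff a w| <= e -> e <= (1 - diff_rate) / 2 * w0 u ->
  `|w'| <= w0 u.
Proof.
move=> hd hw he e1; have h := drift_diff_le hd.
have /andP[l0 l1] := diff_rate_bounds; have w00 := w0_gt0.
move: (u_bounds) => /andP[u0 u1]; have w07 := w0_le.
have h2 : `|w'| <= e + u * `|drift_diff a w|.
  rewrite -(ger0_norm u0) -normrM -lerBlDr.
  by apply: le_trans (lerB_dist _ _) he.
have a2 := sqr_ge0 (`|a|); have w_0 := normr_ge0 w.
have h3 : u * `|drift_diff a w| <= diff_rate * w0 u.
  have -> : diff_rate * w0 u = u * (w0 u * (3 - w0 u ^+ 2) / 2).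
    by rewrite /diff_rate; ring.
  rewrite ler_wpM2l//; apply: le_trans h _.
  rewrite ler_half.
  apply: (@le_trans _ _ (`|w| * (3 - `|w| ^+ 2))).
    by rewrite ler_wpM2l//; lra.
  move: w_0 hw w00 w07; move: (`|w|) (w0 u) => x y x0 xy y0 y7.
  have : 0 <= (y - x) * (3 - x ^+ 2 - x * y - y ^+ 2).
    by rewrite mulr_ge0//; nra.
  lra.
have : 0 <= (1 - diff_rate) * w0 u by rewrite mulr_ge0//; lra.
lra.
Qed.

Lemma sum_lower a w a' e : `|a| + `|w| <= 1 ->
  `|a' - drift_sum a w| <= e ->
  `|a| * (3 - `|a| ^+ 2 - 3 * `|w| ^+ 2) / 2 - e <= `|a'|.
Proof.
move=> hd he; rewrite -drift_sum_abs// lerBlDl -lerBlDr.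
by apply: le_trans (lerB_dist _ _) _; rewrite distrC.
Qed.

Lemma sum_grows a w : `|a| <= eta u -> `|w| <= w0 u ->
  (1 + eta u) * `|a| <= `|a| * (3 - `|a| ^+ 2 - 3 * `|w| ^+ 2) / 2.
Proof.
move=> ha hw; have /andP[e0 e1] := eta_bounds; have E := eta_w0.
have -> : (1 + eta u) * `|a| = `|a| * (2 + 2 * eta u) / 2 by field.
rewrite ler_half ler_wpM2l//.
have : `|w| ^+ 2 <= w0 u ^+ 2 by rewrite lerXn2r ?nnegrE// ltW// w0_gt0.
have : `|a| ^+ 2 <= eta u ^+ 2 by rewrite lerXn2r ?nnegrE// ltW.
nra.
Qed.

(** The function x (2 + 4 y - x^2) is at least its value at x = y on [y, 1]:
    the difference is divisible by x - y, with a nonnegative quotient. *)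
Lemma sum_stays a w : eta u <= `|a| <= 1 -> `|w| <= w0 u ->
  (1 + eta u) * eta u <= `|a| * (3 - `|a| ^+ 2 - 3 * `|w| ^+ 2) / 2.
Proof.
move=> /andP[ha a1] hw; have /andP[e0 e1] := eta_bounds; have E := eta_w0.
have hw2 : `|w| ^+ 2 <= w0 u ^+ 2 by rewrite lerXn2r ?nnegrE// ltW// w0_gt0.
apply: (@le_trans _ _ (`|a| * (2 + 4 * eta u - `|a| ^+ 2) / 2)); last first.
  by rewrite ler_half ler_wpM2l//; lra.
move: (`|a|) (eta u) ha a1 e0 e1 => x y xy x1 y0 y1.
have : 0 <= (x - y) * (2 + 4 * y - x ^+ 2 - x * y - y ^+ 2).
  by rewrite mulr_ge0//; nra.
have : 0 <= y * (2 * y - y ^+ 2) by rewrite mulr_ge0//; nra.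
lra.
Qed.

Definition ratio_rate : R := 4 * u / 3.

Lemma ratio_rate_bounds : 0 <= ratio_rate < 1.
Proof. by rewrite /ratio_rate; move: (u_bounds) => /andP[? ?]; lra. Qed.

(** The slope w / a decreases by the factor 4u/3: on the strip w^2 <= 1/3 the
    growth factors (3 - a^2 - 3w^2) / 2 of a and u (3 - 3a^2 - w^2) / 2 of w
    are in a proportion of at least 3 / (4u). *)
Lemma ratio_contracts a w : `|a| + `|w| <= 1 -> `|w| <= w0 u ->
  u * `|drift_diff a w| * `|a| <= ratio_rate * `|w| * `|drift_sum a w|.
Proof.
move=> hd hw; rewrite drift_sum_abs//; move: (u_bounds) => /andP[u0 u1].
apply: (@le_trans _ _
  (u * (`|w| * (3 - 3 * `|a| ^+ 2 - `|w| ^+ 2) / 2) * `|a|)).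
  by rewrite ler_wpM2r// ler_wpM2l// drift_diff_le.
have hw2 : `|w| ^+ 2 <= w0 u ^+ 2 by rewrite lerXn2r ?nnegrE// ltW// w0_gt0.
rewrite w0_sqr in hw2; have a2 := sqr_ge0 (`|a|).
have : 0 <= (u * `|w| * `|a|) * (3 + 5 * `|a| ^+ 2 - 9 * `|w| ^+ 2) / 6.
  by rewrite divr_ge0// mulr_ge0 ?mulr_ge0//; lra.
rewrite /ratio_rate; lra.
Qed.

(** The weight is small enough for the increase of 1 - |a| caused by w, at most
    3/2 times the slope, to be absorbed by the decrease of the slope. *)
Definition slope_weight : R := (1 - ratio_rate) / 4.

Definition slope_potential a w : R := `|w| / `|a| + slope_weight * (1 - `|a|).

Lemma slope_weight_bounds : 0 < slope_weight <= 1 / 4.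
Proof.
by have /andP[? ?] := ratio_rate_bounds; rewrite /slope_weight; apply/andP; split; lra.
Qed.

Definition slope_rate : R := Num.max ((1 + ratio_rate) / 2) (1 - eta u / 2).

(** Besides the slope, 1 - |a| contracts: without w it is multiplied by
    (1 - |a|) (2 + |a|) / 2, which is at most 1 - eta / 2 for |a| >= eta. *)
Lemma slope_step a w a' w' e : `|a| + `|w| <= 1 ->
  eta u <= `|a| -> `|w| <= w0 u -> 
  `|a' - drift_sum a w| <= e -> `|w' - u * drift_diff a w| <= e ->
  0 <= e <= eta u ^+ 2 ->
  eta u <= `|a'| /\
  slope_potential a' w' <=
    slope_rate * slope_potential a w + 3 / eta u ^+ 2 * e.
Proof.
move=> hd ha hw hea hew /andP[e_0 e_le].
have /andP[y0 y1] := eta_bounds; have /andP[l0 l1] := ratio_rate_bounds.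
move: (u_bounds) => /andP[u0 u1].
have a_0 := normr_ge0 a; have w_0 := normr_ge0 w; have w_7 := w0_le.
have a1 : `|a| <= 1 by lra.
have hF := sum_stays (introT andP (conj ha a1)) hw.
have hF' := sum_lower hd hea.
have a'lo : eta u <= `|a'| by apply: le_trans hF'; nra.
split=> //.
have hr := ratio_contracts hd hw.
rewrite drift_sum_abs// in hr.
set F := `|a| * _ / 2 in hF hF' hr.
have h2 : `|w'| <= e + u * `|drift_diff a w|.
  rewrite -(ger0_norm u0) -normrM -lerBlDr.
  by apply: le_trans (lerB_dist _ _) hew.
have a0 : 0 < `|a| by lra.
have a'0 : 0 < `|a'| by lra.
pose r := `|w| / `|a|.
have r0 : 0 <= r by rewrite divr_ge0.
have wr : `|w| = r * `|a| by rewrite /r divfK ?gt_eqF.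
have ry : r * eta u <= 1.
  by apply: (@le_trans _ _ (`|w|)); [rewrite wr ler_wpM2l|lra].
have hG : u * `|drift_diff a w| <= ratio_rate * r * F.
  by rewrite -(ler_pM2r a0); apply: le_trans hr _; rewrite wr; lra.
have s1 : `|w'| / `|a'| <= ratio_rate * r + 2 / eta u ^+ 2 * e.
  rewrite ler_pdivrMr//.
  have t1 : ratio_rate * r * F <= ratio_rate * r * (`|a'| + e).
    by apply: ler_wpM2l; [exact: mulr_ge0|rewrite -lerBlDr].
  have t2 : ratio_rate * r * e <= r * e.
    by rewrite ler_wpM2r// ler_piMl// ltW.
  have t3 : e + r * e <= 2 / eta u * e.
    have -> : e + r * e = (eta u + r * eta u) / eta u * e.
      by field; rewrite gt_eqF.
    rewrite ler_wpM2r// ler_pM2r ?invr_gt0//; lra.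
  have t4 : 2 / eta u * e <= 2 / eta u ^+ 2 * e * `|a'|.
    have -> : 2 / eta u * e = 2 / eta u ^+ 2 * e * eta u by field; rewrite gt_eqF.
    by rewrite ler_wpM2l// mulr_ge0// divr_ge0// exprn_ge0// ltW.
  lra.
have s2 : 1 - `|a'| <= (1 - eta u / 2) * (1 - `|a|) + 3 / 2 * r + e.
  have q1 : `|a| * `|w| ^+ 2 <= r.
    apply: (@le_trans _ _ (`|w|)); last by rewrite wr ler_piMr.
    rewrite expr2 mulrA ler_piMl// -[1]mulr1 ler_pM//; lra.
  have q2 : 0 <= (1 - `|a|) * ((`|a| - eta u) + `|a| ^+ 2).
    apply: mulr_ge0; first by rewrite subr_ge0.
    by rewrite addr_ge0 ?sqr_ge0// subr_ge0.
  have : F = (3 * `|a| - `|a| ^+ 3 - 3 * (`|a| * `|w| ^+ 2)) / 2.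
    by rewrite /F; ring.
  move: hF' q1 q2; move: (`|a|) (`|w| ^+ 2) => x z; rewrite -/F; lra.
have /andP[k0 k1] := slope_weight_bounds.
have s3 := ler_wpM2l (ltW k0) s2.
rewrite /slope_potential -/r.
have m1 : (1 + ratio_rate) / 2 <= slope_rate by rewrite le_max lexx.
have m2 : 1 - eta u / 2 <= slope_rate by rewrite le_max lexx orbT.
have m3 := ler_wpM2r r0 m1.
have m4 : (1 - eta u / 2) * (slope_weight * (1 - `|a|)) <=
          slope_rate * (slope_weight * (1 - `|a|)).
  by apply: ler_wpM2r => //; apply: mulr_ge0; [exact: ltW|rewrite subr_ge0].
have m5 : slope_weight * e <= 1 / eta u ^+ 2 * e.
  rewrite ler_wpM2r// ler_pdivlMr ?exprn_gt0//.
  by move: k0 k1 y0 y1; move: slope_weight (eta u) => x y; clear; nra.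
have m6 : slope_weight * (3 / 2 * r) <= (1 - ratio_rate) / 2 * r.
  have : 0 <= (1 - ratio_rate) * r by rewrite mulr_ge0// subr_ge0 ltW.
  by rewrite /slope_weight; clear; lra.
by move: s1 s3 m3 m4 m5 m6; clear; lra.
Qed.

End Thresholds.
End MeanField.
(** * One round of voting on a typical graph *)

Section OneRound.
Variables (R : realType) (n : nat) (p q : R).
Hypotheses (q_gt0 : 0 < q) (q_le_p : q <= p) (p_le1 : p <= 1).
Notation V := (sbm_vertex n).
Variables (G : {set {set V}}) (d Kd : R).
Hypotheses (n_gt0 : (0 < n)%N) (d_gt0 : 0 < d) (Kd_ge0 : 0 <= Kd).
Hypothesis typG : typical p q d Kd G.
Implicit Types (A B : {set V}) (v : V) (e : R).

Definition block_sign v : R := if v.1 then 1 else - 1.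

(** The coordinates of an opinion set: the mean alpha and the half-difference
    beta of the biases of the two blocks, in the scale where consensus is
    alpha = 1 or -1. *)
Definition alpha A : R := #|A|%:R / n%:R - 1.

Definition beta A : R := (\sum_(v in A) block_sign v) / n%:R.

Definition contrast : R := (p - q) / (p + q).

Definition wbeta A : R := contrast * beta A.

(** The fraction of opinion 1 that v sees when its neighbourhood is replaced by
    its expectation. *)
Definition mean_frac A v : R := (1 + alpha A + block_sign v * wbeta A) / 2.

Lemma nR_gt0 : 0 < n%:R :> R. Proof. by rewrite ltr0n. Qed.

Lemma pq_gt0 : 0 < p + q.
Proof. by move: (q_gt0) (q_le_p) => ? ?; lra. Qed.

Lemma contrast01 : 0 <= contrast <= 1.
Proof.
have h := pq_gt0; move: (q_gt0) (q_le_p) => ? ?.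
rewrite /contrast ler_pdivrMr// divr_ge0//=; lra.
Qed.

Lemma pair_prob_sum A v :
  \sum_(w in A) pair_prob p q v w = n%:R * (p + q) * mean_frac A v.
Proof.
have h : p + q != 0 by rewrite gt_eqF// pq_gt0.
have n0 : n%:R != 0 :> R by rewrite gt_eqF// nR_gt0.
have -> : \sum_(w in A) pair_prob p q v w =
   \sum_(w in A) ((p + q) / 2 + (p - q) / 2 * block_sign v * block_sign w).
  apply: eq_bigr => w _; rewrite /pair_prob /block_sign.
  by case: v.1; case: w.1; rewrite /=; field.
rewrite big_split/= sumr_const -mulr_sumr -[_ *+ _]mulr_natr.
rewrite /mean_frac /alpha /wbeta /contrast /beta.
by move: (\sum_(i in A) _) (#|A|%:R) (block_sign v) => s a b; field; rewrite h n0.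
Qed.

Lemma sum_block (g : bool -> R) :
  \sum_(v : V) g v.1 = n%:R * (g true + g false).
Proof.
rewrite -(pair_big predT predT (fun b (i : 'I_n) => g b))/= big_bool /=.
by rewrite !sumr_const card_ord mulrDr !mulr_natl.
Qed.

Lemma sum_setT (g : V -> R) : \sum_(v in [set: V]) g v = \sum_v g v.
Proof. by apply: eq_bigl => v; rewrite inE. Qed.

Lemma alphaT : alpha setT = 1.
Proof.
rewrite /alpha cardsT card_V natrM mulfK ?gt_eqF ?nR_gt0//; lra.
Qed.

Lemma betaT : beta setT = 0.
Proof.
by rewrite /beta sum_setT (sum_block (fun b => if b then 1 else - 1)) subrr mulr0
  mul0r.
Qed.

Lemma mean_fracT v : mean_frac setT v = 1.
Proof. by rewrite /mean_frac /wbeta alphaT betaT !mulr0; lra. Qed.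

Lemma mean_frac01 A v : 0 <= mean_frac A v <= 1.
Proof.
have h : 0 < n%:R * (p + q) by rewrite mulr_gt0 ?nR_gt0 ?pq_gt0.
have pp w : 0 <= pair_prob p q v w.
  have /andP[] := pair_prob01 q_gt0 q_le_p p_le1 v w.
  by move=> /(le_trans (ltW q_gt0)).
apply/andP; split; first by rewrite -(pmulr_rge0 _ h) -pair_prob_sum sumr_ge0.
rewrite -(ler_pM2l h) -[X in _ <= _ * X](mean_fracT v) -!pair_prob_sum.
by rewrite sum_setT [leRHS](bigID (mem A))/= lerDl sumr_ge0.
Qed.

Lemma alpha_wbeta A : `|alpha A| + `|wbeta A| <= 1.
Proof.
have := mean_frac01 A (true, Ordinal n_gt0).
have := mean_frac01 A (false, Ordinal n_gt0).
rewrite /mean_frac /block_sign /=; move: (alpha A) (wbeta A) => a w.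
move=> /andP[h1 h2] /andP[h3 h4].
by case: (ger0P a) => ?; case: (ger0P w) => ?; lra.
Qed.

Lemma deg_gt0 v : (0 < #|neighbors G v|)%N.
Proof.
rewrite -(ltr0n R); have [h _] := typG.
by apply: lt_le_trans (h v); rewrite mulr_gt0 ?nR_gt0.
Qed.

(** Both the number of opinion-1 neighbours and the degree deviate from their
    expectations, by the discrepancies of A and of the whole vertex set. *)
Lemma frac_mean_frac A v :
  frac R G A v - mean_frac A v =
  (disc p q G v A - mean_frac A v * disc p q G v setT) / #|neighbors G v|%:R.
Proof.
have dv : #|neighbors G v|%:R != 0 :> R by rewrite pnatr_eq0 -lt0n deg_gt0.
rewrite /disc !pair_prob_sum mean_fracT setIT /frac.
by field.
Qed.

Definition bias_const : R := 4 * Kd / d.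

Lemma bias_const_ge0 : 0 <= bias_const.
Proof. by apply: divr_ge0; [exact: mulr_ge0|exact: ltW]. Qed.

(** The bound is uniform in A because only an l^1 bound on the discrepancies
    enters, and [maj3] is Lipschitz. *)
Lemma adopt_bias A :
  \sum_v `|adopt R G A v - maj3 (mean_frac A v)| <= bias_const * Num.sqrt n%:R.
Proof.
have [hd hD] := typG; have n0 := nR_gt0; have d0 := d_gt0.
have dn0 : 0 < d * n%:R by rewrite mulr_gt0.
apply: (@le_trans _ _ (\sum_v 2 / (d * n%:R) *
    (`|disc p q G v A| + `|disc p q G v setT|))).
  apply: ler_sum => v _.
  apply: le_trans (maj3_lipschitz (frac01 R G A v) (mean_frac01 A v)) _.
  have -> : 2 / (d * n%:R) * (`|disc p q G v A| + `|disc p q G v setT|) =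
    2 * ((`|disc p q G v A| + `|disc p q G v setT|) / (d * n%:R)).
    by rewrite mulrAC mulrA.
  rewrite ler_wpM2l// frac_mean_frac normrM normfV ler_pM ?invr_ge0//.
    apply: le_trans (ler_normB _ _) _; rewrite lerD2l normrM ler_piMl//.
    by have /andP[x0 x1] := mean_frac01 A v; rewrite ger0_norm.
  rewrite normr_nat lef_pV2 ?posrE ?hd//.
  by rewrite ltr0n deg_gt0.
rewrite -mulr_sumr big_split/=.
apply: (@le_trans _ _ (2 / (d * n%:R) * (2 * (Kd * (n%:R * Num.sqrt n%:R))))).
  apply: ler_wpM2l; first by rewrite divr_ge0// ltW.
  by rewrite [leRHS]mulr_natl mulr2n lerD.
rewrite le_eqVlt; apply/orP; left; apply/eqP; rewrite /bias_const.
by field; rewrite !gt_eqF.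
Qed.

Notation P A := (adopt R G A).

Lemma mean_sum A : \sum_v maj3 (mean_frac A v) =
  n%:R * (1 + drift_sum (alpha A) (wbeta A)).
Proof.
rewrite (sum_block (fun b => maj3 ((1 + alpha A +
  (if b then 1 else - 1) * wbeta A) / 2))).
by rewrite mul1r mulN1r maj3_sum.
Qed.

Lemma mean_diff A : \sum_v block_sign v * maj3 (mean_frac A v) =
  n%:R * drift_diff (alpha A) (wbeta A).
Proof.
rewrite (sum_block (fun b => (if b then 1 else - 1) * maj3 ((1 + alpha A +
  (if b then 1 else - 1) * wbeta A) / 2))).
by rewrite !mul1r !mulN1r maj3_diff.
Qed.

Lemma block_sign_norm v : `|block_sign v| = 1.
Proof. by rewrite /block_sign; case: ifP; rewrite ?normrN normr1. Qed.

Lemma weighted_bias A (c : V -> R) : (forall v, `|c v| <= 1) ->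
  `|\sum_v c v * P A v - \sum_v c v * maj3 (mean_frac A v)| <=
  bias_const * Num.sqrt n%:R.
Proof.
move=> hc; apply: le_trans (adopt_bias A).
rewrite -sumrB; apply: le_trans (ler_norm_sum _ _ _) _.
by apply: ler_sum => v _; rewrite -mulrBr normrM ler_piMl.
Qed.

Lemma sum_in (c : V -> R) B : \sum_(v in B) c v = \sum_v c v * (v \in B)%:R.
Proof.
rewrite big_mkcond/=; apply: eq_bigr => v _.
by case: (v \in B); rewrite ?mulr1 ?mulr0.
Qed.

Lemma linE (c : V -> R) A B :
  lin (P A) c B = \sum_(v in B) c v - \sum_v c v * P A v.
Proof. by rewrite sum_in -sumrB; apply: eq_bigr => v _; rewrite mulrBr. Qed.

Lemma alpha_step A B : n%:R * alpha B =
  n%:R * drift_sum (alpha A) (wbeta A) + lin (P A) (fun=> 1) B +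
  (\sum_v 1 * P A v - \sum_v 1 * maj3 (mean_frac A v)).
Proof.
have n0 := nR_gt0.
have -> : \sum_v 1 * maj3 (mean_frac A v) = \sum_v maj3 (mean_frac A v).
  by apply: eq_bigr => v _; rewrite mul1r.
rewrite mean_sum linE /alpha sumr_const.
by field; rewrite gt_eqF.
Qed.

Lemma beta_step A B : n%:R * beta B =
  n%:R * drift_diff (alpha A) (wbeta A) + lin (P A) block_sign B +
  (\sum_v block_sign v * P A v - \sum_v block_sign v * maj3 (mean_frac A v)).
Proof.
by rewrite mean_diff linE /beta mulrC divfK ?gt_eqF ?nR_gt0//; ring.
Qed.

Definition near e A B : bool :=
  (`|alpha B - drift_sum (alpha A) (wbeta A)| <= e) &&
  (`|wbeta B - contrast * drift_diff (alpha A) (wbeta A)| <= e).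

Lemma PrE A (E : pred {set V}) :
  Pr (P A) E = \sum_(B | E B) kernel R G A B.
Proof.
rewrite /Pr /Ex [RHS]big_mkcond/=; apply: eq_bigr => B _.
by case: (E B); rewrite ?mulr1 ?mulr0.
Qed.

Lemma sqrt_facts : 0 < Num.sqrt n%:R :> R /\ Num.sqrt n%:R ^+ 2 = n%:R :> R.
Proof. by rewrite sqrtr_gt0 nR_gt0 sqr_sqrtr ?ltW ?nR_gt0. Qed.

Lemma cardV_le : #|{: V}|%:R <= 2 * n%:R :> R.
Proof. by rewrite card_V natrM. Qed.

Lemma lin_tail A (c : V -> R) (s : R) : (forall v, `|c v| <= 1) ->
  0 < s <= 4 * n%:R ->
  Pr (P A) (fun B => s <= `|lin (P A) c B|) <= 32 * n%:R / s ^+ 2.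
Proof.
move=> hc /andP[s0 s1].
have := tail_unit (adopt01 R G A) (N := 2 * n%:R) (s := s) hc cardV_le.
have -> : 16 * (2 * n%:R) = 32 * n%:R :> R by ring.
by apply; apply/andP; split=> //; lra.
Qed.

(** For sqrt n large the bias takes up at most half of the precision e; the other
    half is left to the fluctuations, of order n^(-1/2). *)
Lemma near_whp e A : 0 < e <= 1 -> 2 * bias_const / e <= Num.sqrt n%:R ->
  \sum_(B | ~~ near e A B) kernel R G A B <= 256 / e ^+ 2 / n%:R.
Proof.
move=> /andP[e0 e1] hn; rewrite -PrE; have n0 := nR_gt0.
have [r0 rn] := sqrt_facts; set r := Num.sqrt n%:R in hn r0 rn.
have hb : bias_const * r <= e / 2 * n%:R.
  rewrite -rn expr2 mulrA ler_pM2r//.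
  by move: hn; rewrite ler_pdivrMr//; lra.
have s0 : 0 < e / 2 * n%:R by rewrite mulr_gt0// divr_gt0.
have s1 : e / 2 * n%:R <= 4 * n%:R by rewrite ler_pM2r//; lra.
have t1 := lin_tail A (c := fun=> 1) (s := e / 2 * n%:R)
  (fun=> ltac:(by rewrite normr1)) (introT andP (conj s0 s1)).
have t2 := lin_tail A (c := block_sign) (s := e / 2 * n%:R)
  (fun v => ltac:(by rewrite block_sign_norm)) (introT andP (conj s0 s1)).
have -> : 256 / e ^+ 2 / n%:R =
    32 * n%:R / (e / 2 * n%:R) ^+ 2 + 32 * n%:R / (e / 2 * n%:R) ^+ 2.
  by field; rewrite !gt_eqF.
apply: le_trans _ (lerD t1 t2).
apply: le_trans (Pr_or (adopt01 R G A) _ _).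
apply: (Pr_le (adopt01 R G A)) => B.
rewrite /near negb_and -!ltNge => /orP[] h; apply/orP; [left|right].
  have E := alpha_step A B.
  have hw := weighted_bias A (c := fun=> 1) (fun=> ltac:(by rewrite normr1)).
  rewrite -/r in hw; set bi := _ - _ in E hw.
  have : e * n%:R <= `|n%:R * (alpha B - drift_sum (alpha A) (wbeta A))|.
    by rewrite normrM (gtr0_norm n0) mulrC ler_pM2l// ltW.
  have -> : n%:R * (alpha B - drift_sum (alpha A) (wbeta A)) =
            lin (P A) (fun=> 1) B + bi by rewrite mulrBr E; ring.
  by move=> h1; have := ler_normD (lin (P A) (fun=> 1) B) bi; lra.
have E := beta_step A B.
have hw := weighted_bias A (c := block_sign)
  (fun v => ltac:(by rewrite block_sign_norm)).
rewrite -/r in hw; set bi := _ - _ in E hw.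
have : e * n%:R <= `|n%:R * (beta B - drift_diff (alpha A) (wbeta A))|.
  rewrite normrM (gtr0_norm n0) mulrC ler_pM2l//.
  apply: le_trans (ltW h) _; rewrite /wbeta -mulrBr normrM ler_piMl//.
  by have /andP[c0 c1] := contrast01; rewrite ger0_norm.
have -> : n%:R * (beta B - drift_diff (alpha A) (wbeta A)) =
          lin (P A) block_sign B + bi by rewrite mulrBr E; ring.
by move=> h1; have := ler_normD (lin (P A) block_sign B) bi; lra.
Qed.

(** Exchanging the two opinions is a symmetry of the process. *)
Lemma kernel_setC A B : kernel R G (~: A) (~: B) = kernel R G A B.
Proof.
apply: eq_bigr => v _; rewrite inE.
have -> : adopt R G (~: A) v = 1 - adopt R G A v.
  rewrite /adopt -maj3_comp; congr maj3.
  have dv : #|neighbors G v|%:R != 0 :> R by rewrite pnatr_eq0 -lt0n deg_gt0.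
  rewrite /frac -[X in X - _](divff dv) -mulrBl; congr (_ / _).
  by rewrite -setDE cardsD natrB// subset_leq_card// subsetIl.
by case: (v \in B); rewrite //= opprB addrC subrK.
Qed.

(** A vertex must sample the minority at least twice, and the minority A makes
    up at most a fraction #|A| / (d n) of any neighbourhood. *)
Lemma adopt_small A : \sum_v P A v <= 6 / d ^+ 2 * (#|A|%:R / n%:R) * #|A|%:R.
Proof.
have n0 := nR_gt0; have [hd _] := typG; have d0 := d_gt0.
apply: (@le_trans _ _ (\sum_(v : V) 3 * (#|A|%:R / (d * n%:R)) ^+ 2)).
  apply: ler_sum => v _; have /andP[f0 f1] := frac01 R G A v.
  apply: (@le_trans _ _ (3 * frac R G A v ^+ 2)).
    rewrite /adopt /maj3; have : 0 <= frac R G A v ^+ 3 by rewrite exprn_ge0.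
    by lra.
  have dv : 0 < #|neighbors G v|%:R :> R by rewrite ltr0n deg_gt0.
  have hx : frac R G A v <= #|A|%:R / (d * n%:R).
    rewrite /frac ler_pM ?invr_ge0 ?ler_nat ?subset_leq_card ?subsetIr//.
    by rewrite lef_pV2 ?posrE ?mulr_gt0.
  by rewrite ler_wpM2l// lerXn2r// nnegrE (le_trans f0).
rewrite sumr_const card_V -[leLHS]mulr_natl natrM le_eqVlt.
by apply/orP; left; apply/eqP; field; rewrite !gt_eqF.
Qed.

Lemma ex_card A : \sum_B kernel R G A B * #|B|%:R = \sum_v P A v.
Proof.
transitivity (Ex (P A) (fun B => \sum_v (v \in B)%:R)).
  by apply: eq_bigr => B _; rewrite sum_mem.
by rewrite Ex_sum; apply: eq_bigr => v _; rewrite Ex_mem.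
Qed.

(** The fractions (1 + alpha + w) / 2 and (1 + alpha - w) / 2 stay away from 0
    and 1. *)
Lemma adopt_var A : `|alpha A| <= 1 / 4 -> `|wbeta A| <= 7 / 12 ->
  64 * bias_const <= Num.sqrt n%:R ->
  1 / 64 * n%:R <= \sum_v P A v * (1 - P A v).
Proof.
move=> ha hw hn; have [r0 rn] := sqrt_facts.
have hb := adopt_bias A; set r := Num.sqrt n%:R in hn r0 rn hb.
have h1 : 64 * (bias_const * r) <= n%:R by rewrite -rn expr2 mulrA ler_pM2r.
have h2 : \sum_v (1 / 64 - `|P A v - maj3 (mean_frac A v)|) <=
          \sum_v P A v * (1 - P A v).
  apply: ler_sum => v _.
  have : 1 / 64 <= maj3 (mean_frac A v) * (1 - maj3 (mean_frac A v)).
    apply: maj3_var.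
    have -> : 2 * mean_frac A v - 1 = alpha A + block_sign v * wbeta A.
      by rewrite /mean_frac; field.
    apply: le_trans (ler_normD _ _) _; rewrite normrM block_sign_norm mul1r.
    by lra.
  have /andP[a0 a1] := adopt01 R G A v.
  have /andP[b0 b1] := maj3_ge0 (mean_frac01 A v).
  move: a0 a1 b0 b1; move: (P A v) (maj3 _) => x y x0 x1 y0 y1 hy.
  have e1 : x * (1 - x) = y * (1 - y) + (x - y) * (1 - x - y) by ring.
  have e2 : `|(x - y) * (1 - x - y)| <= `|x - y|.
    by rewrite normrM ler_piMr// ler_norml; apply/andP; split; lra.
  have := ler_norm (- ((x - y) * (1 - x - y))); rewrite normrN.
  by lra.
have h3 : \sum_(v : V) (1 / 64 : R) = n%:R / 32.
  by rewrite sumr_const card_V -[LHS]mulr_natl natrM; field.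
apply: le_trans h2; rewrite sumrB h3; lra.
Qed.

End OneRound.
(** * From an arbitrary opinion set to consensus *)

Section Phases.
Variables (R : realType) (n : nat) (p q : R).
Hypotheses (q_gt0 : 0 < q) (q_le_p : q <= p) (p_le1 : p <= 1).
Notation V := (sbm_vertex n).
Variables (G : {set {set V}}) (d Kd : R).
Hypotheses (n_gt0 : (0 < n)%N) (d_gt0 : 0 < d) (d_le1 : d <= 1).
Hypothesis Kd_ge0 : 0 <= Kd.
Hypothesis typG : typical p q d Kd G.
Notation u := (contrast p q).
Hypothesis u_bounds : 0 <= u < 3 / 4.
Implicit Types (A B : {set V}).

Notation K := (kernel R G).
Notation alpha := (@alpha R n).
Notation wbeta := (@wbeta R n p q).
Notation Cb := (bias_const d Kd).
Notation rn := (Num.sqrt n%:R : R).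

(** A minority of at most theta n vertices is halved in expectation, by
    [adopt_small]. *)
Definition theta : R := d ^+ 2 / 12.

Lemma theta_bounds : 0 < theta <= 1 / 12.
Proof.
move: (d_gt0) (d_le1) => d0 d1.
have h : d ^+ 2 <= 1 by rewrite exprn_ile1// ltW.
have h0 : 0 < d ^+ 2 by rewrite exprn_gt0.
by rewrite /theta; apply/andP; split; lra.
Qed.

Lemma slope_rate_bounds : 0 < slope_rate u < 1.
Proof.
have /andP[e0 e1] := eta_bounds u_bounds.
have /andP[l0 l1] := ratio_rate_bounds u_bounds.
rewrite /slope_rate lt_max gt_max; apply/andP; split.
  by apply/orP; left; lra.
by apply/andP; split; lra.
Qed.

(** The precision of one round that the drift of each regime tolerates. *)
Definition tol : R :=
  Num.min ((1 - diff_rate u) / 2 * w0 u)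
    (Num.min (eta u ^+ 2)
      ((1 - slope_rate u) / 2 * (slope_weight u * theta) * (eta u ^+ 2 / 3))).

Lemma tol_bounds : 0 < tol <= 1.
Proof.
have /andP[t0 t1] := theta_bounds; have /andP[s0 s1] := slope_rate_bounds.
have /andP[k0 k1] := slope_weight_bounds u_bounds.
have /andP[e0 e1] := eta_bounds u_bounds.
have /andP[l0 l1] := diff_rate_bounds u_bounds.
have w00 := w0_gt0 u_bounds.
have e2 : 0 < eta u ^+ 2 by rewrite exprn_gt0.
have h1 : eta u ^+ 2 <= 1 by rewrite exprn_ile1//; lra.
apply/andP; split; last by rewrite /tol !ge_min h1 /= orbT.
rewrite /tol !lt_min e2 /=; apply/andP; split; first by apply: mulr_gt0 => //; lra.
apply: mulr_gt0; last exact: divr_gt0.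
by apply: mulr_gt0; [lra|exact: mulr_gt0].
Qed.

Lemma tol_diff : tol <= (1 - diff_rate u) / 2 * w0 u.
Proof. by rewrite /tol ge_min lexx. Qed.

Lemma tol_eta : tol <= eta u ^+ 2.
Proof. by rewrite /tol !ge_min lexx orbT. Qed.

Lemma tol_slope :
  tol <= (1 - slope_rate u) / 2 * (slope_weight u * theta) * (eta u ^+ 2 / 3).
Proof. by rewrite /tol !ge_min lexx !orbT. Qed.

Definition one_round_err : R := 256 / tol ^+ 2 / n%:R.

Hypothesis n_large : 2 * Cb / tol <= rn.

Lemma err_ge0 : 0 <= one_round_err.
Proof.
have /andP[t0 _] := tol_bounds.
by rewrite divr_ge0// divr_ge0// exprn_ge0// ltW.
Qed.

Lemma near_tol A : \sum_(B | ~~ near p q tol A B) K A B <= one_round_err.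
Proof. exact: near_whp tol_bounds n_large. Qed.

Definition in_strip A : bool := `|wbeta A| <= w0 u.

Definition off_axis A : bool := in_strip A && (eta u <= `|alpha A|).

Definition near_consensus A : bool := 1 - `|alpha A| <= theta.

Lemma aw1 A : `|alpha A| + `|wbeta A| <= 1.
Proof. exact: alpha_wbeta. Qed.

Lemma alpha_le1 A : `|alpha A| <= 1.
Proof. by have := aw1 A; have := normr_ge0 (wbeta A); lra. Qed.

Lemma reach_strip t A :
  miss K in_strip t A <= ((1 + diff_rate u) / 2) ^+ t / w0 u + t%:R * one_round_err.
Proof.
have /andP[l0 l1] := diff_rate_bounds u_bounds; have w00 := w0_gt0 u_bounds.
apply: (@le_trans _ _ (((1 + diff_rate u) / 2) ^+ t * `|wbeta A| / w0 u +
                       t%:R * one_round_err)).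
  apply: (@miss_contract R _ K (@kernel_ge0 R _ G) (@kernel_sum R _ G)
    predT in_strip (near p q tol) (fun B => `|wbeta B|) _ _ _) => //.
  - by lra.
  - exact: err_ge0.
  - by move=> B _; rewrite /in_strip -ltNge => /ltW.
  - by move=> B _ _; exact: near_tol.
  move=> B C _; rewrite /in_strip -!ltNge => hB /andP[_ hC] _; split=> //.
  exact (diff_contracts u_bounds (aw1 B) (ltW hB) hC tol_diff).
rewrite lerD2r ler_pM2r ?invr_gt0// ler_piMr ?exprn_ge0//; first lra.
by have := aw1 A; have := normr_ge0 (alpha A); lra.
Qed.

Lemma strip_stable A B : in_strip A -> near p q tol A B -> in_strip B.
Proof.
move=> hA /andP[_ hB].
exact (diff_stays u_bounds (aw1 A) hA hB tol_diff).
Qed.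

Lemma reach_near_consensus t A : off_axis A ->
  miss K near_consensus t A <=
  ((1 + slope_rate u) / 2) ^+ t * (1 / eta u + 1) / (slope_weight u * theta) +
  t%:R * one_round_err.
Proof.
have /andP[s0 s1] := slope_rate_bounds.
have /andP[k0 k1] := slope_weight_bounds u_bounds.
have /andP[e0 e1] := eta_bounds u_bounds.
have /andP[t0 t1] := theta_bounds; have /andP[tol0 tol1] := tol_bounds.
have kt0 : 0 < slope_weight u * theta by rewrite mulr_gt0.
have phi0 B : 0 <= slope_potential u (alpha B) (wbeta B).
  apply: addr_ge0; first exact: divr_ge0.
  by apply: mulr_ge0; [exact: ltW|rewrite subr_ge0; exact: alpha_le1].
have philb B : ~~ near_consensus B ->
    slope_weight u * theta <= slope_potential u (alpha B) (wbeta B).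
  rewrite /near_consensus -ltNge => hB.
  rewrite /slope_potential -[leLHS]add0r lerD ?divr_ge0//.
  by rewrite ler_pM2l// ltW.
move=> hA; apply: (@le_trans _ _ (((1 + slope_rate u) / 2) ^+ t *
  slope_potential u (alpha A) (wbeta A) / (slope_weight u * theta) +
                       t%:R * one_round_err)).
  apply: (@miss_contract R _ K (@kernel_ge0 R _ G) (@kernel_sum R _ G)
    off_axis near_consensus (near p q tol)
    (fun B => slope_potential u (alpha B) (wbeta B)) _ _ _) => //.
  - by lra.
  - exact: err_ge0.
  - by move=> B _; exact: philb.
  - by move=> B _ _; exact: near_tol.
  move=> B C /andP[wB aB] nB nBC nC; have /andP[n1 n2] := nBC.
  have [|aC hC] := slope_step u_bounds (aw1 B) aB wB n1 n2.
    by rewrite (ltW tol0) tol_eta.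
  split; first by rewrite /off_axis (strip_stable wB nBC).
  apply: le_trans hC _.
  have h1 := philb B nB.
  have h2 : 3 / eta u ^+ 2 * tol <= (1 - slope_rate u) / 2 * (slope_weight u * theta).
    rewrite mulrC -ler_pdivlMr ?divr_gt0 ?exprn_gt0// invf_div.
    exact: tol_slope.
  have h3 : (1 - slope_rate u) / 2 * (slope_weight u * theta) <=
    (1 - slope_rate u) / 2 * slope_potential u (alpha B) (wbeta B).
    by rewrite ler_wpM2l//; lra.
  lra.
rewrite lerD2r ler_pM2r ?invr_gt0// ler_wpM2l ?exprn_ge0//; first lra.
have /andP[wA aA] := hA; have a0 : 0 < `|alpha A| by lra.
rewrite /slope_potential lerD//.
  rewrite ler_pM ?invr_ge0// ?lef_pV2//.
  by have := aw1 A; have := normr_ge0 (alpha A); lra.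
have : 0 <= slope_weight u * `|alpha A| by rewrite mulr_ge0// ltW.
lra.
Qed.

(** The first summand makes the fluctuations, and the second one the bias, small
    compared with the growth eta |alpha| of one round. *)
Definition escape_height : R := 64 / eta u ^+ 2 + 4 * Cb / eta u.

(** The parameter L of [anticoncentration], for a variance of at least n / 64 and
    a height that leaves twice [escape_height] after an adverse bias and an
    adverse mean of the next alpha. *)
Definition kick_scale : R := 8 * ((4 * escape_height + Cb) + 2) / (1 / 64).

Definition kick_prob : R :=
  expR (kick_scale ^+ 2 * (1 / 64) / 4 - 16 * kick_scale ^+ 2) / 2.

Definition escape_rate : R := Num.max (1 - eta u / 8) (1 - kick_prob / 2).

Notation h := escape_height.

Lemma Cb_ge0 : 0 <= Cb. Proof. exact: bias_const_ge0. Qed.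

Lemma height_ge : 64 / eta u ^+ 2 <= h /\ 4 * Cb / eta u <= h.
Proof.
have /andP[e0 e1] := eta_bounds u_bounds.
rewrite /h lerDl lerDr; split.
  by apply: divr_ge0; [apply: mulr_ge0 => //; exact: Cb_ge0|exact: ltW].
by rewrite divr_ge0 ?exprn_ge0// ltW.
Qed.

Lemma height_ge1 : 1 <= h.
Proof.
have /andP[e0 e1] := eta_bounds u_bounds; have [h1 _] := height_ge.
apply: le_trans h1; rewrite ler_pdivlMr ?exprn_gt0//.
have : eta u ^+ 2 <= 1 by rewrite exprn_ile1//; lra.
lra.
Qed.

Lemma kick_prob_bounds : 0 < kick_prob <= 1 / 2.
Proof.
rewrite /kick_prob divr_gt0 ?expR_gt0//= ler_half expR_le1.
by have := sqr_ge0 kick_scale; lra.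
Qed.

Lemma escape_rate_bounds : 0 < escape_rate < 1.
Proof.
have /andP[e0 e1] := eta_bounds u_bounds.
have /andP[k0 k1] := kick_prob_bounds.
rewrite /escape_rate lt_max gt_max; apply/andP; split.
  by apply/orP; left; lra.
by apply/andP; split; lra.
Qed.

(** The power -1 of sqrt n |alpha| makes the probability of order
    1 / (n alpha^2) that a fluctuation throws the process back to the axis, where
    the potential is 1, negligible compared with the potential itself. *)
Definition escape_potential A : R := h / Num.max h (rn * `|alpha A|).

Lemma escape_potential_bounds A : 0 <= escape_potential A <= 1.
Proof.
have h1 := height_ge1; have h0 : 0 < h by lra.
have hm : h <= Num.max h (rn * `|alpha A|) by rewrite le_max lexx.
have m0 := lt_le_trans h0 hm.
by rewrite /escape_potential divr_ge0 ?(ltW h0) ?(ltW m0)//= ler_pdivrMr ?mul1r.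
Qed.

Lemma escape_potential_le A (z : R) : 0 < z -> z <= rn * `|alpha A| ->
  escape_potential A <= h / z.
Proof.
have h1 := height_ge1; have h0 : 0 < h by lra.
move=> z0 hz; rewrite /escape_potential ler_pM2l// lef_pV2 ?posrE//.
  by rewrite le_max hz orbT.
by rewrite lt_max h0.
Qed.

(** Unless the fluctuation exceeds eta / 4 |alpha| n, the growth by 1 + eta / 2
    divides the potential by as much; otherwise the potential is at most 1. *)
Lemma escape_far A : `|alpha A| <= eta u -> in_strip A ->
  h <= rn * `|alpha A| ->
  Ex (adopt R G A) escape_potential <= (1 - eta u / 8) * escape_potential A.
Proof.
move=> aA wA hA; have /andP[e0 e1] := eta_bounds u_bounds.
have [hg1 hg2] := height_ge; have h1 := height_ge1.
have h0 : 0 < h by lra.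
have n0 := nR_gt0 R n_gt0; have [r0 r2] := sqrt_facts R n_gt0.
set r := Num.sqrt _ in r0 r2 hA.
have a0 : 0 < `|alpha A|.
  by rewrite -(pmulr_rgt0 _ r0); apply: lt_le_trans h0 hA.
set a := `|alpha A| in aA hA a0; set Z := r * a in hA.
have Z0 : 0 < Z by lra.
have -> : escape_potential A = h / Z.
  by rewrite /escape_potential -/r -/a -/Z; case: ltP => // hh; have -> : h = Z by lra.
pose s := eta u / 4 * a * n%:R.
have s0 : 0 < s.
  by apply: mulr_gt0 => //; apply: mulr_gt0 => //; exact: divr_gt0.
have s4 : s <= 4 * n%:R.
  by rewrite ler_pM2r//; have a1 := alpha_le1 A; rewrite -/a in a1; nra.
have tl := lin_tail G A (c := fun=> 1) (s := s)
  (fun=> ltac:(by rewrite normr1)) (introT andP (conj s0 s4)).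
apply: (@le_trans _ _ (32 * n%:R / s ^+ 2 + h / ((1 + eta u / 2) * Z))).
  apply: le_trans (lerD tl (lexx _)); rewrite -[X in _ + X](Ex_cst (adopt R G A)).
  rewrite -ExD; apply: (ler_Ex (adopt01 R G A)) => B.
  have /andP[p0 p1] := escape_potential_bounds B.
  case: (boolP (s <= _)) => hs /=.
    have : 0 <= h / ((1 + eta u / 2) * Z).
      by rewrite divr_ge0 ?mulr_ge0 ?(ltW h0) ?(ltW Z0)//; lra.
    by rewrite mulr1n; lra.
  rewrite mulr0n add0r -ltNge in hs *.
  apply: escape_potential_le; first by rewrite mulr_gt0//; lra.
  rewrite -/r /Z mulrCA ler_pM2l//.
  have E := alpha_step p q G n_gt0 A B.
  have hw := weighted_bias q_gt0 q_le_p p_le1 n_gt0 d_gt0 typG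
    A (c := fun=> 1) (fun=> ltac:(by rewrite normr1)).
  rewrite -/r in hw; set bi := _ - _ in E hw; set li := lin _ _ _ in E hs.
  have hb : Cb * r <= eta u / 4 * a * n%:R.
    rewrite -r2 expr2 mulrA ler_pM2r//.
    have h3 : 4 * Cb <= eta u * h by move: hg2; rewrite ler_pdivrMr//; lra.
    have h4 : eta u * h <= eta u * Z by rewrite ler_pM2l.
    by rewrite /Z in h4; lra.
  have gr := sum_grows u_bounds aA wA; rewrite -/a in gr.
  rewrite -drift_sum_abs in gr; last exact: aw1.
  have nabs (x : R) : n%:R * `|x| = `|n%:R * x| by rewrite normrM gtr0_norm.
  rewrite -(ler_pM2l n0) [leRHS]nabs E.
  have g2 := ler_wpM2l (ltW n0) gr; rewrite [leRHS]nabs in g2.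
  set dr := n%:R * drift_sum _ _ in g2 *.
  have t1 := lerB_dist dr (- (li + bi)).
  rewrite opprK in t1; rewrite -(addrA dr).
  have t2 : `|- (li + bi)| <= `|li| + `|bi| by rewrite normrN ler_normD.
  rewrite /s in hs; lra.
have sZ : s ^+ 2 = eta u ^+ 2 / 16 * Z ^+ 2 * n%:R.
  by rewrite /s /Z -r2; field.
have p1 : 32 * n%:R / s ^+ 2 <= eta u / 8 * (h / Z).
  have -> : 32 * n%:R / s ^+ 2 = 512 / eta u ^+ 2 / Z / Z.
    by rewrite sZ; field; rewrite !gt_eqF.
  have -> : eta u / 8 * (h / Z) = eta u / 8 * h / Z by rewrite mulrA.
  rewrite ler_pM2r ?invr_gt0// ler_pdivrMr//.
  have q1 : 64 / eta u ^+ 2 * (64 / eta u ^+ 2) <= h * Z.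
    rewrite ler_pM ?divr_ge0 ?exprn_ge0 ?(ltW e0)//; lra.
  have q2 : 512 / eta u ^+ 2 <= eta u / 8 * (64 / eta u ^+ 2 * (64 / eta u ^+ 2)).
    have -> : eta u / 8 * (64 / eta u ^+ 2 * (64 / eta u ^+ 2)) =
              512 / eta u ^+ 2 / eta u by field; rewrite gt_eqF.
    rewrite ler_pdivlMr// ler_piMr ?divr_ge0 ?exprn_ge0 ?(ltW e0)//; lra.
  apply: le_trans q2 _; rewrite -[leRHS]mulrA; apply: ler_wpM2l => //; lra.
have p2 : h / ((1 + eta u / 2) * Z) <= (1 - eta u / 4) * (h / Z).
  have -> : h / ((1 + eta u / 2) * Z) = (1 + eta u / 2)^-1 * (h / Z).
    by field; rewrite !gt_eqF//; lra.
  rewrite ler_pM2r ?divr_gt0// -div1r ler_pdivrMr; last lra.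
  have : 0 <= eta u * (2 - eta u) by apply: mulr_ge0; lra.
  lra.
lra.
Qed.

(** The potential is 1, its maximum, and with probability at least [kick_prob]
    the next value is at most 1/2. *)
Lemma escape_close A : `|alpha A| <= eta u -> in_strip A ->
  rn * `|alpha A| <= h ->
  64 * Cb <= rn -> 16 * kick_scale ^+ 2 <= n%:R ->
  Ex (adopt R G A) escape_potential <= (1 - kick_prob / 2) * escape_potential A.
Proof.
move=> aA wA hA n1 n2; have h1 := height_ge1; have h0 : 0 < h by lra.
have /andP[e0 e1] := eta_bounds u_bounds.
have n0 := nR_gt0 R n_gt0; have [r0 r2] := sqrt_facts R n_gt0.
have -> : escape_potential A = 1.
  by rewrite /escape_potential max_l// divff// gt_eqF.
rewrite mulr1.
set r := Num.sqrt _ in r0 r2 hA n1.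
have va : 1 / 64 * n%:R <= \sum_v adopt R G A v * (1 - adopt R G A v).
  apply: (adopt_var q_gt0 q_le_p p_le1 n_gt0 d_gt0 typG) => //; first lra.
  by apply: le_trans wA (w0_le u_bounds).
have c0 := Cb_ge0.
have := anticoncentration (adopt01 R G A) (a := 1 / 64) (H := 4 * h + Cb) (n := n)
  ltac:(lra) ltac:(lra) n2 (cardV_le R n) va.
rewrite -/kick_scale -/kick_prob -/r => kp.
have : Ex (adopt R G A) escape_potential <=
    Ex (adopt R G A) (fun B => 1 + (- (1 / 2)) *
      ((4 * h + Cb) * r <= lin (adopt R G A) (fun=> 1) B)%R%:R).
  apply: (ler_Ex (adopt01 R G A)) => B.
  have /andP[p0 p1] := escape_potential_bounds B.
  case: (boolP ((4 * h + Cb) * r <= _)) => hs /=; last by rewrite mulr0 addr0.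
  rewrite mulr1.
  suff : escape_potential B <= h / (2 * h).
    by rewrite invfM mulrCA divff ?gt_eqF// mulr1; lra.
  apply: escape_potential_le; first by lra.
  have E := alpha_step p q G n_gt0 A B.
  have hw := weighted_bias q_gt0 q_le_p p_le1 n_gt0 d_gt0 typG
    A (c := fun=> 1) (fun=> ltac:(by rewrite normr1)).
  rewrite -/r in hw; set bi := _ - _ in E hw; set li := lin _ _ _ in E hs.
  have dr : n%:R * `|drift_sum (alpha A) (wbeta A)| <= 3 / 2 * h * r.
    have d1 : `|drift_sum (alpha A) (wbeta A)| <= 3 / 2 * `|alpha A|.
      rewrite drift_sum_abs ?aw1//.
      have : 0 <= `|alpha A| * (`|alpha A| ^+ 2 + 3 * `|wbeta A| ^+ 2).
        by rewrite mulr_ge0// addr_ge0// ?mulr_ge0// sqr_ge0.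
      lra.
    apply: le_trans (ler_wpM2l (ltW n0) d1) _.
    have -> : n%:R * (3 / 2 * `|alpha A|) = 3 / 2 * (r * `|alpha A|) * r.
      by rewrite -r2; ring.
    by rewrite ler_pM2r// ler_pM2l//; lra.
  have d2 := ler_norm (- (n%:R * drift_sum (alpha A) (wbeta A))).
  rewrite normrN normrM (gtr0_norm n0) in d2.
  have b2 := ler_norm (- bi); rewrite normrN in b2.
  rewrite -/r -(ler_pM2r r0).
  have -> : r * `|alpha B| * r = n%:R * `|alpha B| by rewrite -r2; ring.
  apply: (@le_trans _ _ (n%:R * alpha B)); last by rewrite ler_pM2l// ler_norm.
  rewrite E; have : 0 <= h * r by rewrite mulr_ge0 ?ltW.
  lra.
rewrite ExD Ex_cst => /le_trans; apply.
by rewrite ExZ -/(Pr _ _); lra.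
Qed.

Lemma reach_off_axis t A : in_strip A ->
  h <= rn -> 64 * Cb <= rn -> 16 * kick_scale ^+ 2 <= n%:R ->
  miss K off_axis t A <= escape_rate ^+ t * rn + t%:R * one_round_err.
Proof.
move=> hA n1 n2 n3; have /andP[x0 x1] := escape_rate_bounds.
have h1 := height_ge1; have h0 : 0 < h by lra.
have n0 := nR_gt0 R n_gt0; have [r0 r2] := sqrt_facts R n_gt0.
apply: (@le_trans _ _ (escape_rate ^+ t * escape_potential A / (h / rn) +
                       t%:R * one_round_err)); last first.
  rewrite lerD2r -mulrA ler_pM2l ?exprn_gt0// invf_div mulrA ler_pdivrMr//.
  have /andP[p0 p1] := escape_potential_bounds A.
  rewrite mulrC ler_pM2l//; lra.
apply: (@miss_drift R _ K (@kernel_ge0 R _ G) (@kernel_sum R _ G)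
    in_strip off_axis (fun _ B => in_strip B) escape_potential) => //.
- exact: ltW.
- by rewrite divr_gt0.
- exact: err_ge0.
- by move=> B; have /andP[] := escape_potential_bounds B.
- move=> B _ _; rewrite /escape_potential ler_pM2l// lef_pV2 ?posrE//.
    by rewrite ge_max n1 /= ler_piMr ?alpha_le1// ltW.
  by rewrite lt_max h0.
- by move=> B _ _ C ->.
- move=> B hB _; apply: le_trans (near_tol B).
  rewrite [leRHS]big_mkcond [leLHS]big_mkcond/=; apply: ler_sum => C _.
  have k0 := kernel_ge0 R G B C.
  case: (boolP (in_strip C)) => hC /=; first by case: ifP.
  case: (boolP (near _ _ _ _ _)) => //= nC.
  by rewrite (strip_stable hB nC) in hC.
move=> B hB nB; have aB : `|alpha B| <= eta u.
  by move: nB; rewrite /off_axis hB /= -ltNge => /ltW.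
apply: (@le_trans _ _ (Ex (adopt R G B) escape_potential)).
  rewrite /Ex [leRHS](bigID (fun C => in_strip C && ~~ off_axis C))/= lerDl.
  apply: sumr_ge0 => C _; have /andP[p0 _] := escape_potential_bounds C.
  by rewrite mulr_ge0//; exact: kernel_ge0.
have /andP[pB0 _] := escape_potential_bounds B.
case: (leP h (rn * `|alpha B|)) => hz.
  apply: le_trans (escape_far aB hB hz) _.
  by rewrite ler_wpM2r// /escape_rate le_max lexx.
apply: le_trans (escape_close aB hB (ltW hz) n2 n3) _.
by rewrite ler_wpM2r// /escape_rate le_max lexx orbT.
Qed.

Definition exit_err : R := 128 / theta ^+ 2 / n%:R.

Lemma die_out t A : #|A|%:R <= theta * n%:R ->
  miss K (pred1 set0) t A <= (1 / 2) ^+ t * (2 * n%:R) + t%:R * exit_err.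
Proof.
move=> hA; have /andP[th0 th1] := theta_bounds.
have n0 := nR_gt0 R n_gt0; have d0 := d_gt0.
have mean B : #|B|%:R <= theta * n%:R ->
    \sum_v adopt R G B v <= 1 / 2 * #|B|%:R.
  move=> hB; apply: le_trans (adopt_small n_gt0 d_gt0 typG B) _.
  rewrite ler_wpM2r//.
  have -> : 1 / 2 = 6 / d ^+ 2 * theta :> R by rewrite /theta; field; rewrite gt_eqF.
  rewrite ler_wpM2l ?divr_ge0 ?exprn_ge0 ?(ltW d0)//.
  by rewrite ler_pdivrMr.
apply: (@le_trans _ _ ((1 / 2) ^+ t * #|A|%:R / 1 + t%:R * exit_err)); last first.
  rewrite lerD2r divr1 ler_wpM2l//; first by rewrite exprn_ge0 ?divr_ge0.
  by rewrite -natrM ler_nat -card_V max_card.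
apply: (@miss_drift R _ K (@kernel_ge0 R _ G) (@kernel_sum R _ G)
    (fun B => #|B|%:R <= theta * n%:R) (pred1 set0)
    (fun _ B => #|B|%:R <= theta * n%:R) (fun B => #|B|%:R)) => //.
- exact: divr_ge0.
- by do 2!apply: divr_ge0 => //; exact: sqr_ge0.
- by move=> B _ /=; rewrite -cards_eq0 -lt0n ler1n.
- by move=> B _ _ C ->.
- move=> B hB _.
  have s0 : 0 < theta / 2 * n%:R by rewrite mulr_gt0// divr_gt0.
  have s4 : theta / 2 * n%:R <= 4 * n%:R by rewrite ler_pM2r//; lra.
  have tl := lin_tail G B (c := fun=> 1) (s := theta / 2 * n%:R)
    (fun=> ltac:(by rewrite normr1)) (introT andP (conj s0 s4)).
  have -> : exit_err = 32 * n%:R / (theta / 2 * n%:R) ^+ 2.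
    by rewrite /exit_err; field; rewrite !gt_eqF.
  apply: le_trans tl; rewrite -PrE; apply: (Pr_le (adopt01 R G B)) => C hC.
  rewrite -ltNge in hC; apply: le_trans (ler_norm _).
  rewrite linE sumr_const; have := mean B hB.
  have -> : \sum_v 1 * adopt R G B v = \sum_v adopt R G B v.
    by apply: eq_bigr => v _; rewrite mul1r.
  lra.
move=> B hB _; apply: le_trans (mean B hB); rewrite -ex_card.
rewrite [leRHS](bigID (fun C : {set V} =>
  (#|C|%:R <= theta * n%:R) && (C != set0)))/= lerDl.
by apply: sumr_ge0 => C _; rewrite mulr_ge0// kernel_ge0.
Qed.

(** If alpha is close to 1 the minority is the complement of A, and the symmetry
    between the opinions applies. *)
Lemma finish t A : near_consensus A ->
  miss K (@consensus V) t A <= (1 / 2) ^+ t * (2 * n%:R) + t%:R * exit_err.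
Proof.
have n0 := nR_gt0 R n_gt0; have sub B : pred1 set0 B -> @consensus V B.
  by move=> /eqP ->; rewrite /consensus eqxx.
have small B : alpha B <= 0 -> near_consensus B -> #|B|%:R <= theta * n%:R.
  move=> hB; rewrite /near_consensus ler0_norm//.
  by rewrite /alpha => hc; rewrite -ler_pdivrMr//; lra.
move=> hA; case: (lerP (alpha A) 0) => aA.
  apply: le_trans (die_out t (small A aA hA)).
  exact: (miss_sub (@kernel_ge0 R _ G)).
have aC : alpha (~: A) = - alpha A.
  rewrite /alpha cardsCs setCK natrB ?max_card// card_V natrM.
  by field; rewrite gt_eqF.
have symc B : @consensus V (~: B) = @consensus V B.
  rewrite /consensus orbC; congr (_ || _).
    by rewrite -(inj_eq (can_inj (@setCK _))) setCK setCT.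
  by rewrite -(inj_eq (can_inj (@setCK _))) setCK setC0.
have kC := kernel_setC n_gt0 d_gt0 typG.
rewrite -(miss_sym (f := @setC V) t A (@setCK _)) //.
apply: le_trans (die_out t (small (~: A) _ _)).
- exact: (miss_sub (@kernel_ge0 R _ G)).
- by rewrite aC oppr_le0 ltW.
- by rewrite /near_consensus aC normrN.
Qed.

Lemma reach_consensus t A :
  h <= rn -> 64 * Cb <= rn -> 16 * kick_scale ^+ 2 <= n%:R ->
  miss K (@consensus V) (t + (t + (t + t))) A <=
    ((1 + diff_rate u) / 2) ^+ t / w0 u +
    escape_rate ^+ t * rn +
    ((1 + slope_rate u) / 2) ^+ t * (1 / eta u + 1) / (slope_weight u * theta) +
    (1 / 2) ^+ t * (2 * n%:R) +
    t%:R * (3 * one_round_err + exit_err).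
Proof.
move=> n1 n2 n3.
have comp := miss_comp (@kernel_ge0 R _ G) (@kernel_sum R _ G).
have err0 : 0 <= t%:R * one_round_err by rewrite mulr_ge0// err_ge0.
have exit0 : 0 <= t%:R * exit_err.
  by rewrite mulr_ge0// /exit_err; do 2!apply: divr_ge0 => //; exact: sqr_ge0.
have /andP[s0 s1] := slope_rate_bounds.
have /andP[x0 x1] := escape_rate_bounds.
have /andP[e0 e1] := eta_bounds u_bounds.
have /andP[k0 k1] := slope_weight_bounds u_bounds.
have /andP[th0 th1] := theta_bounds.
set b1 := _ / w0 u; set b2 := _ * rn; set b3 := _ / (_ * theta).
set b4 := _ * (2 * _).
have b2_ge0 : 0 <= b2 by rewrite mulr_ge0 ?exprn_ge0 ?sqrtr_ge0// ltW.
have b3_ge0 : 0 <= b3.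
  apply: divr_ge0; last by apply: mulr_ge0; exact: ltW.
  apply: mulr_ge0; first by apply: exprn_ge0; lra.
  by apply: addr_ge0 => //; apply: divr_ge0 => //; exact: ltW.
have b4_ge0 : 0 <= b4.
  by apply: mulr_ge0; [apply: exprn_ge0; lra|exact: mulr_ge0].
have c4 B : near_consensus B -> miss K (@consensus V) t B <= b4 + t%:R * exit_err.
  exact: finish.
have c3 B : off_axis B -> miss K (@consensus V) (t + t) B <=
    (b3 + t%:R * one_round_err) + (b4 + t%:R * exit_err).
  move=> hB; apply: le_trans (comp near_consensus _ _ t t _ c4 B) _.
    by rewrite addr_ge0.
  by rewrite lerD2r reach_near_consensus.
have c2 B : in_strip B -> miss K (@consensus V) (t + (t + t)) B <=
    (b2 + t%:R * one_round_err) +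
    ((b3 + t%:R * one_round_err) + (b4 + t%:R * exit_err)).
  move=> hB; apply: le_trans (comp off_axis _ _ t (t + t)%N _ c3 B) _.
    by rewrite !addr_ge0.
  by rewrite lerD2r reach_off_axis.
apply: le_trans (comp in_strip _ _ t (t + (t + t))%N _ c2 A) _.
  by rewrite !addr_ge0.
have := reach_strip t A; rewrite -/b1; lra.
Qed.

End Phases.
(** * Logarithmic time *)

Section LogTime.
Variable R : realType.
Implicit Types (n t : nat) (l : R).

Lemma ln_le_sqrt n : (0 < n)%N -> ln n%:R <= 2 * Num.sqrt n%:R :> R.
Proof.
move=> n0; have nR : 0 < n%:R :> R by rewrite ltr0n.
have r0 : 0 < Num.sqrt n%:R :> R by rewrite sqrtr_gt0.
have E : n%:R = Num.sqrt n%:R ^+ 2 :> R by rewrite sqr_sqrtr// ltW.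
rewrite [in leLHS]E lnXn// -[leLHS]mulr_natl ler_pM2l// ltW//.
exact: ln_sublinear.
Qed.

(** Because l <= expR (l - 1); rounding the time costs the factor [expR 1]. *)
Lemma geometric_log_time n t l : (0 < n)%N -> 0 < l < 1 ->
  2 / (1 - l) * ln n%:R < t.+1%:R ->
  l ^+ t <= expR 1 / n%:R ^+ 2.
Proof.
move=> n0 /andP[l0 l1] ht; have nR : 0 < n%:R :> R by rewrite ltr0n.
apply: (@le_trans _ _ (expR (- (1 - l)) ^+ t)).
  rewrite lerXn2r ?nnegrE ?expR_ge0 ?(ltW l0)//.
  by apply: le_trans (expR_ge1Dx _); lra.
rewrite -expRM_natl.
have -> : expR 1 / n%:R ^+ 2 = expR (1 - 2 * ln n%:R) :> R.
  by rewrite expRD expRN expRM_natl lnK ?posrE.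
rewrite ler_expR.
have h : 2 * ln n%:R < t.+1%:R * (1 - l).
  by move: ht; rewrite mulrAC ltr_pdivrMr//; lra.
rewrite -natr1 in h; lra.
Qed.

End LogTime.

Section Main.
Variables (R : realType) (p q : R).
Hypotheses (q_gt0 : 0 < q) (q_le_p : q <= p) (p_le1 : p <= 1).
Hypothesis ratio : 1 / 7 < q / p.
Notation u := (contrast p q).
Notation Cb := (bias_const (q / 2) 23).

Lemma contrast_bounds : 0 <= u < 3 / 4.
Proof.
move: (q_gt0) (q_le_p) (ratio) => q0 qp hr.
have p0 : 0 < p by lra.
have h : p < 7 * q by move: hr; rewrite ltr_pdivlMr//; lra.
rewrite /contrast ltr_pdivrMr; last lra.
by rewrite divr_ge0//=; lra.
Qed.

Definition rate : R :=
  Num.max (Num.max ((1 + diff_rate u) / 2) (escape_rate p q (q / 2) 23))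
          (Num.max ((1 + slope_rate u) / 2) (1 / 2)).

Lemma rate_bounds : 0 < rate < 1.
Proof.
have ub := contrast_bounds.
have /andP[d0 d1] := diff_rate_bounds ub.
have /andP[s0 s1] := slope_rate_bounds ub.
have qh : 0 < q / 2 by exact: divr_gt0.
have /andP[x0 x1] : 0 < escape_rate p q (q / 2) 23 < 1.
  exact: escape_rate_bounds.
have h1 : 0 < (1 + diff_rate u) / 2 < 1 by apply/andP; split; lra.
have h2 : 0 < (1 + slope_rate u) / 2 < 1 by apply/andP; split; lra.
have max01 (a b : R) : 0 < a < 1 -> 0 < b < 1 -> 0 < Num.max a b < 1.
  by move=> /andP[? ?] /andP[? ?]; rewrite lt_max gt_max; apply/and3P; split;
    rewrite ?orbT//; apply/orP; left.
have h3 : 0 < escape_rate p q (q / 2) 23 < 1 by rewrite x0.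
have h4 : 0 < (1 / 2 : R) < 1 by apply/andP; split; lra.
exact: max01 (max01 _ _ h1 h3) (max01 _ _ h2 h4).
Qed.

Lemma rate_ge :
  [/\ (1 + diff_rate u) / 2 <= rate, escape_rate p q (q / 2) 23 <= rate,
      (1 + slope_rate u) / 2 <= rate & 1 / 2 <= rate].
Proof.
rewrite /rate; move: (_ / 2) (escape_rate _ _ _ _) (_ / 2) (1 / 2) => a b c d.
by rewrite !le_max !lexx !orbT.
Qed.

Definition time_const : R := 2 / (1 - rate).

Definition err_const : R :=
  3 * (256 / tol p q (q / 2) ^+ 2) + 128 / theta (q / 2) ^+ 2.

Definition potential_const : R :=
  1 / w0 u + (1 / eta u + 1) / (slope_weight u * theta (q / 2)).

Definition failure_const : R :=
  expR 1 * (potential_const + 3) + 2 * time_const * err_const.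

(** A sum instead of a maximum: every summand is nonnegative, so each is a lower
    bound for sqrt n once the sum is. *)
Definition size_const : R :=
  2 * Cb / tol p q (q / 2) + escape_height p q (q / 2) 23 + 64 * Cb +
  4 * kick_scale p q (q / 2) 23 + (27 + 54 * 128 ^+ 3 / q ^+ 6).

Lemma time_const_gt0 : 0 < time_const.
Proof. by have /andP[? ?] := rate_bounds; apply: divr_gt0 => //; lra. Qed.

Lemma Cb0 : 0 <= Cb.
Proof. by apply: bias_const_ge0 => //; exact: divr_gt0. Qed.

Lemma height_gt0 : 0 < escape_height p q (q / 2) 23.
Proof.
have := @height_ge1 _ p q (q / 2) 23 ltac:(exact: divr_gt0) (ler0n R 23)
  contrast_bounds.
lra.
Qed.

Lemma size_const_bounds (r : R) : size_const <= r ->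
  [/\ 2 * Cb / tol p q (q / 2) <= r, escape_height p q (q / 2) 23 <= r,
      64 * Cb <= r, 0 <= 4 * kick_scale p q (q / 2) 23 <= r &
      27 + 54 * 128 ^+ 3 / q ^+ 6 <= r].
Proof.
rewrite /size_const => hr; have c0 := Cb0; have h0 := height_gt0.
have /andP[t0 _] : 0 < tol p q (q / 2) <= 1.
  apply: tol_bounds contrast_bounds; first exact: divr_gt0.
  by move: (q_gt0) (q_le_p) (p_le1) => ? ? ?; lra.
have a0 : 0 <= 2 * Cb / tol p q (q / 2).
  by apply: divr_ge0; [exact: mulr_ge0|exact: ltW].
have k0 : 0 <= kick_scale p q (q / 2) 23.
  by rewrite /kick_scale; apply: divr_ge0 => //; lra.
have g0 : 0 <= 54 * 128 ^+ 3 / q ^+ 6.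
  by apply: divr_ge0; [apply: mulr_ge0 => //; exact: exprn_ge0|
    apply: exprn_ge0; exact: ltW].
by split; [lra|lra|lra|apply/andP; split; lra|lra].
Qed.

(** The potentials lose a factor n^2 in the given time, against initial ratios of
    order at most n; the exceptional rounds, of probability O(1 / n) each, add
    O(log n / n). *)
Lemma typical_consensus (n t : nat) (G : {set {set sbm_vertex n}}) A :
  (0 < n)%N -> size_const <= Num.sqrt n%:R -> typical p q (q / 2) 23 G ->
  t%:R <= time_const * ln n%:R < t.+1%:R ->
  miss (kernel R G) (@consensus _) (t + (t + (t + t))) A <=
    failure_const / Num.sqrt n%:R.
Proof.
move=> n0 hn typ /andP[t1 t2]; have ub := contrast_bounds.
have q2 : 0 < q / 2 by exact: divr_gt0.
have q1 : q / 2 <= 1 by move: (q_gt0) (q_le_p) (p_le1) => ? ? ?; lra.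
have [s1 s2 s3 /andP[s4 s5] _] := size_const_bounds hn.
have nR : 0 < n%:R :> R by rewrite ltr0n.
have nR1 : 1 <= n%:R :> R by rewrite ler1n.
have k2 : 16 * kick_scale p q (q / 2) 23 ^+ 2 <= n%:R.
  have -> : 16 * kick_scale p q (q / 2) 23 ^+ 2 =
    (4 * kick_scale p q (q / 2) 23) ^+ 2 by ring.
  rewrite -(sqr_sqrtr (ltW nR)) lerXn2r// nnegrE; exact: le_trans s5.
apply: le_trans (reach_consensus q_gt0 q_le_p p_le1 n0 q2 q1 (ler0n R 23) typ ub
  s1 t A s2 s3 k2) _.
set r := Num.sqrt n%:R.
have r0 : 0 < r by rewrite sqrtr_gt0.
have rn : n%:R = r ^+ 2 by rewrite sqr_sqrtr// ltW.
have r1 : 1 <= r by rewrite -[leLHS]sqrtr1 ler_wsqrtr.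
have rle : r <= n%:R by rewrite rn expr2 ler_peMl// ltW.
have /andP[w00 _] : 0 < w0 u <= 7 / 12.
  by rewrite (w0_gt0 ub) (w0_le ub).
have /andP[e0 _] := eta_bounds ub.
have /andP[k0 _] := slope_weight_bounds ub.
have /andP[th0 _] : 0 < theta (q / 2) <= 1 / 12 by exact: theta_bounds.
have kt0 : 0 < slope_weight u * theta (q / 2) by exact: mulr_gt0.
have /andP[l0 l1] := rate_bounds; have [m1 m2 m3 m4] := rate_ge.
have pw x : 0 <= x -> x <= rate -> x ^+ t <= expR 1 / n%:R ^+ 2.
  move=> x0 hx; apply: (@le_trans _ _ (rate ^+ t)).
    by rewrite lerXn2r// nnegrE ltW.
  by apply: geometric_log_time n0 _ t2; rewrite l0.
set E := expR 1 / n%:R ^+ 2 in pw.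
have E0 : 0 <= E by apply: divr_ge0; [exact: expR_ge0|exact: sqr_ge0].
have /andP[d0 _] := diff_rate_bounds ub.
have /andP[sl0 _] := slope_rate_bounds ub.
have /andP[x0 _] : 0 < escape_rate p q (q / 2) 23 < 1 by exact: escape_rate_bounds.
have b1 := pw _ (divr_ge0 (addr_ge0 ler01 d0) (ler0n R 2)) m1.
have b2 := pw _ (ltW x0) m2.
have b3 := pw _ (divr_ge0 (addr_ge0 ler01 (ltW sl0)) (ler0n R 2)) m3.
have b4 := pw _ (divr_ge0 ler01 (ler0n R 2)) m4.
set c3 := (1 / eta u + 1) / (slope_weight u * theta (q / 2)).
have c30 : 0 <= c3.
  apply: divr_ge0; last exact: ltW.
  by apply: addr_ge0 => //; apply: divr_ge0 => //; exact: ltW.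
have p1 : ((1 + diff_rate u) / 2) ^+ t / w0 u <= E * (1 / w0 u) * n%:R.
  rewrite mul1r; apply: le_trans (_ : E / w0 u <= _).
    by rewrite ler_pM2r ?invr_gt0.
  by rewrite ler_peMr// divr_ge0// ltW.
have p2 : escape_rate p q (q / 2) 23 ^+ t * r <= E * n%:R.
  by apply: ler_pM => //; [apply: exprn_ge0; exact: ltW|exact: ltW].
have p3 : ((1 + slope_rate u) / 2) ^+ t * (1 / eta u + 1) /
    (slope_weight u * theta (q / 2)) <= E * c3 * n%:R.
  rewrite -mulrA -/c3; apply: le_trans (_ : E * c3 <= _).
    exact: ler_wpM2r.
  by rewrite ler_peMr// mulr_ge0.
have p4 : (1 / 2) ^+ t * (2 * n%:R) <= E * (2 * n%:R).
  by apply: ler_wpM2r => //; rewrite mulr_ge0// ltW.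
have -> : 3 * one_round_err n p q (q / 2) + exit_err n (q / 2) =
          err_const / n%:R.
  rewrite /one_round_err /exit_err /err_const.
  by move: (256 / _) (128 / _) (n%:R^-1) => a b c; ring.
have ec0 : 0 <= err_const.
  rewrite /err_const; apply: addr_ge0; first apply: mulr_ge0 => //;
  by apply: divr_ge0 => //; exact: sqr_ge0.
have p5 : t%:R * (err_const / n%:R) <= 2 * time_const * err_const / r.
  have h : t%:R <= 2 * time_const * r.
    apply: le_trans t1 _; have -> : 2 * time_const * r = time_const * (2 * r) by ring.
    by apply: ler_wpM2l; [exact: ltW time_const_gt0|exact: ln_le_sqrt].
  have -> : 2 * time_const * err_const / r =
     2 * time_const * r * (err_const / n%:R) by rewrite rn; field; rewrite gt_eqF.
  by apply: ler_wpM2r h; apply: divr_ge0 => //; exact: ltW.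
have En : E * n%:R <= expR 1 / r.
  have -> : E * n%:R = expR 1 / n%:R by rewrite /E; field; rewrite gt_eqF.
  by rewrite ler_pM2l ?expR_gt0// lef_pV2.
have pc0 : 0 <= potential_const + 3.
  by apply: addr_ge0 => //; apply: addr_ge0 => //; apply: divr_ge0 => //; exact: ltW.
apply: (@le_trans _ _ (E * n%:R * (potential_const + 3) +
                       2 * time_const * err_const / r)).
  rewrite /potential_const -/c3; move: p1 p2 p3 p4 p5; clear; lra.
have -> : failure_const / r = expR 1 / r * (potential_const + 3) +
  2 * time_const * err_const / r by rewrite /failure_const mulrDl; congr (_ + _); ring.
by rewrite lerD2r ler_wpM2r.
Qed.

End Main.

Theorem theorem1p4 (R : realType) (p q : R) :
  0 < q -> q <= p -> p <= 1 -> q / p > 1 / 7 ->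
  exists C C' K c : R, [/\ 0 < C, 0 < C', 0 < c &
    exists N : nat, forall n : nat, (N <= n)%N ->
      sbm_Pr p q (fun G : {set {set sbm_vertex n}} =>
        forall (A : {set sbm_vertex n}) (T : nat),
          C * ln n%:R <= T%:R ->
          vote_Pr G R (fun s : T.-tuple (sampling (sbm_vertex n)) =>
            (Tcons A s)%:R <= C * ln (n%:R : R))
          >= 1 - K * n%:R `^ (- C'))
      >= 1 - n%:R `^ (- c)].
Proof.
move=> q0 qp p1 ratio.
have tc0 : 0 < time_const p q by exact: time_const_gt0.
exists (4 * time_const p q), 2^-1, (failure_const p q), 1; split=> //.
- exact: mulr_gt0.
- by rewrite invr_gt0.
pose M := size_const p q.
exists (maxn 16 (Num.trunc (M ^+ 2)).+1) => n; rewrite geq_max => /andP[n16 hM].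
have n0 : (0 < n)%N by apply: leq_trans n16.
have nR : 0 < n%:R :> R by rewrite ltr0n.
have nR1 : 1 <= n%:R :> R by rewrite ler1n.
have hr : M <= Num.sqrt n%:R.
  apply: le_trans (ler_norm _) _; rewrite -sqrtr_sqr ler_wsqrtr//.
  by apply: ltW; apply: lt_le_trans (truncnS_gt _) _; rewrite ler_nat.
have [_ _ _ _ hC] : [/\ _, _, _, _ & _] := size_const_bounds q0 qp p1 ratio hr.
set Q := fun G : {set {set sbm_vertex n}} => _.
apply: le_trans (typical_whp q0 qp p1 n16 (Q := Q) _); last first.
  move=> G _ typ A T hT; pose t := Num.trunc (time_const p q * ln n%:R).
  have ln0 : 0 <= ln n%:R :> R by exact: ln_ge0.
  have ht : t%:R <= time_const p q * ln n%:R < t.+1%:R.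
    by apply: truncn_itv; apply: mulr_ge0 => //; exact: ltW.
  have t4 : (t + (t + (t + t)))%:R <= 4 * time_const p q * ln n%:R.
    by have /andP[? _] := ht; rewrite !natrD; lra.
  have tT : (t + (t + (t + t)) <= T)%N.
    by rewrite -(ler_nat R); apply: le_trans hT.
  have dg := deg_gt0 n0 (divr_gt0 q0 (ltr0n R 2)) typ.
  apply: le_trans (vote_Pr_ge R dg (A := A) tT _); last first.
    by move=> s hs; apply: le_trans t4; rewrite ler_nat.
  rewrite powRN powR12_sqrt ?(ltW nR)// lerD2l lerN2.
  exact: typical_consensus.
rewrite powRN powRr1 ?(ltW nR)// lerD2l lerN2 ler_pdivrMr ?exprn_gt0//.
have -> : n%:R^-1 * n%:R ^+ 2 = n%:R :> R by field; rewrite gt_eqF.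
apply: le_trans hC _; have rn : Num.sqrt n%:R ^+ 2 = n%:R :> R by rewrite sqr_sqrtr// ltW.
rewrite -[leRHS]rn expr2 ler_peMl ?sqrtr_ge0//.
by rewrite -[leLHS]sqrtr1 ler_wsqrtr.
Qed.
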